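(* The function $G_h:L^2(\Omega)\to L^2(\Omega)$, $$G_h(v):=v-P_{[a,b]}\Bigl(-\frac1\alpha p_h(y_h(v))\Bigr),$$ is $\partial G_h$-semismooth of order $\mu$ for every $0<\mu<\frac13$, where the generalized differential $\partial G_h$ is given by $$\partial G_h(v)w=w+\frac1\alpha\,\partial P_{[a,b]}\Bigl(-\frac1\alpha p_h(y_h(v))\Bigr)\cdot\bigl(S_h^*S_hw\bigr),\qquad v,w\in L^2(\Omega),$$ and the application of the differential $\partial P_{[a,b]}$ and the multiplication by $S_h^*S_hw$ are pointwise operations a.e. in $\Omega$.
   Context: $\Omega\subset\mathbb R^d$ ($d\ge1$) is an open, bounded, (sufficiently regular) polyhedral domain, $Y:=H_0^1(\Omega)$, $z\in L^2(\Omega)$, $\alpha>0$. Finite elements: $\bar\Omega=\bigcup_{j=1}^{nt}\bar T_j$ is an admissible partition into simplices from a quasi-uniform sequence of partitions (the partition is fixed here). Piecewise linear elements are used: $W_h:=\{v\in C^0(\bar\Omega): v|_{T_j}\in\mathbb P_1(T_j)\text{ for all }j\}$ and $Y_h:=\{v\in W_h: v|_{\partial\Omega}=0\}\subset Y$. The bounds satisfy $a,b\in W_h$ and $b-a>\sigma>0$ on $\Omega$ for some constant $\sigma\in\mathbb R$. $S_h:L^2(\Omega)\to Y_h\subset L^2(\Omega)$ is the discrete solution operator of $-\Delta$ with homogeneous Dirichlet conditions: $\int_\Omega\nabla(S_hf)\cdot\nabla v_h\,dx=\int_\Omega f v_h\,dx$ for all $v_h\in Y_h$; $S_h^*$ is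 its adjoint, whose range also lies in $Y_h$. For $v\in L^2(\Omega)$ set $y_h(v):=S_hv$ and $p_h(y_h(v)):=S_h^*(S_hv-z)\in Y_h$. $P_{[a,b]}$ denotes pointwise projection: $P_{[a,b]}(f)(\omega)=\max(a(\omega),\min(b(\omega),f(\omega)))$. Its generalized differential is the set-valued map with, for real $x$ and at the point $\omega$, $\partial P_{[a(\omega),b(\omega)]}(x)=\{0\}$ if $x\notin[a(\omega),b(\omega)]$, $\{1\}$ if $x\in(a(\omega),b(\omega))$, and $[0,1]$ if $x=a(\omega)$ or $x=b(\omega)$. Thus $\partial G_h(v)$ is the set of all bounded linear operators $M$ on $L^2(\Omega)$ of the form $Mw=w+\frac1\alpha\,g\cdot(S_h^*S_hw)$ with $g\in L^\infty(\Omega)$ and $g(\omega)\in\partial P_{[a(\omega),b(\omega)]}\bigl(-\frac1\alpha p_h(y_h(v))(\omega)\bigr)$ for a.e. $\omega\in\Omega$. Semismoothness: for Banach spaces $X,Z$, a continuous map $G:X\to Z$ and a set-valued map $\partial G$ assigning to each $v\in X$ a nonempty set of bounded linear operators $X\to Z$, $G$ is called $\partial G$-semismooth of order $\mu>0$ if for every $v\in X$ $$\sup_{M\in\partial G(v+s)}\|G(v+s)-G(v)-Ms\|_Z=O\bigl(\|s\|_X^{1+\mu}\bigr)\quad\text{as }\|s\|_X\to0.$$ *)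

(* Defs.v *)
From HB Require Import structures.
From mathcomp Require Import all_boot all_order all_algebra.
From mathcomp Require Import all_classical all_reals all_analysis.
From mathcomp Require Import measurable_realfun ess_sup_inf.

Set Implicit Arguments.
Unset Strict Implicit.
Unset Printing Implicit Defensive.
Import Order.TTheory GRing.Theory Num.Theory.
Import numFieldNormedType.Exports.

Local Open Scope classical_set_scope.
Local Open Scope ring_scope.

(* The library defines the Lebesgue space as a quotient of measurable functions
   by a.e. equality; here it is made a normed module.  An element coerces to a
   chosen representative, hence pointwise statements about it are only meaningful
   almost everywhere. *)
Section Lspace_normed_module.
Context d (T : measurableType d) (R : realType).
Variables (mu : {measure set T -> \bar R}) (p : \bar R) (p1 : (1 <= p)%E).

Lemma eq_ae_Lnorm (f g : T -> R) :
  measurable_fun setT f -> measurable_fun setT g -> f = g %[ae mu] ->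
  ('N[mu]_p[EFin \o f] = 'N[mu]_p[EFin \o g])%E.
Proof.
suff H (u v : T -> R) : measurable_fun setT u -> measurable_fun setT v ->
    u = v %[ae mu] -> ('N[mu]_p[EFin \o u] <= 'N[mu]_p[EFin \o v])%E.
  move=> mf mg fg; apply/eqP; rewrite eq_le; apply/andP; split; apply: H => //.
  by apply: filterS fg => x h /h ->.
move=> mu_ mv uv; set w : T -> R := u \- v.
have mw : measurable_fun setT w by exact: measurable_funB.
have -> : u = (v \+ w)%R by apply/funext => x; rewrite /w /= addrC subrK.
apply: (le_trans (eminkowski _ _ _ p1)) => //.
suff -> : ('N[mu]_p[EFin \o w] = 0)%E by rewrite adde0.
have w0 : \forall x \ae mu, w x = 0.
  by apply: filterS uv => x /(_ I) /= e; rewrite /w /= e subrr.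
rewrite unlock; case: (p) p1 => [r r1|_|//].
- have r0 : r != 0 by rewrite gt_eqF// (lt_le_trans ltr01)// -lee_fin.
  rewrite (_ : (\int[mu]_x _)%E = 0%E); first by rewrite poweR0r// invr_neq0.
  rewrite -(integral0 mu setT); apply: ae_eq_integral => //.
    apply: (@measurableT_comp _ _ _ _ _ _ (fun x : \bar R => (x `^ r)%E)).
      exact: measurable_poweR.
    by apply: measurableT_comp => //; exact/measurable_EFinP.
  by apply: filterS w0 => x /= -> _; rewrite normr0 powR0.
- case: ifPn => // mu0; apply: ess_sup_ae_cst => //.
  by apply: filterS w0 => x /= ->; rewrite normr0.
Qed.

Section class_of.
Variable f : LfunType mu p1.

Definition to_mfunR : T -> measurableTypeR R := f.

Lemma measurable_to_mfunR : measurable_fun setT to_mfunR.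
Proof. exact: (@measurable_funPT _ _ _ _ f). Qed.

HB.instance Definition _ :=
  isMeasurableFun.Build _ _ T (measurableTypeR R) to_mfunR measurable_to_mfunR.

Definition Lclass_mfun : {mfun_ mu, T >-> measurableTypeR R} :=
  \pi_({mfun_ mu, T >-> measurableTypeR R})%qT to_mfunR.

Lemma Lclass_mfun_ae : (Lclass_mfun : T -> R) = f %[ae mu].
Proof.
have : (repr Lclass_mfun = to_mfunR
          %[mod {mfun_ mu, T >-> measurableTypeR R}])%qT by rewrite reprK.
by move/eqquotP => /asboolP.
Qed.

Lemma Lclass_finite : finite_norm mu p Lclass_mfun.
Proof.
rewrite /finite_norm (eq_ae_Lnorm _ _ Lclass_mfun_ae).
- exact: Lfunction_finite.
- exact: (@measurable_funPT _ _ _ _ (repr Lclass_mfun)).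
- by [].
Qed.

HB.instance Definition _ := isFinLebesgue.Build d T R mu p p1 Lclass_mfun Lclass_finite.
Definition Lclass : LspaceType mu p1 := Lclass_mfun.

Lemma LclassE : (Lclass : T -> R) = f %[ae mu].
Proof. exact: Lclass_mfun_ae. Qed.

End class_of.

Section fun_of.
Variable u : LspaceType mu p1.
Definition Lrepr_fun : T -> R := u.

Lemma measurable_Lspace : measurable_fun setT Lrepr_fun.
Proof. exact: (@measurable_funPT _ _ _ _ (repr (u : {mfun_ mu, T >-> measurableTypeR R}))). Qed.

HB.instance Definition _ := isMeasurableFun.Build _ _ T R Lrepr_fun measurable_Lspace.
HB.instance Definition _ := isLfunction.Build d T R mu p p1 Lrepr_fun Lebesgue_finite.
Definition Lrepr : LfunType mu p1 := Lrepr_fun.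
End fun_of.


Lemma Lspace_eqP (u v : LspaceType mu p1) : u = v <-> (u : T -> R) = v %[ae mu].
Proof.
split=> [->|uv]; first exact: ae_eq_refl.
have : (u : {mfun_ mu, T >-> measurableTypeR R}) = (v : {mfun_ mu, T >-> measurableTypeR R}).
  by rewrite -[LHS]reprK -[RHS]reprK; apply/eqquotP/asboolP.
case: u {uv} => u [[uP]]; case: v => v [[vP]] /= uv.
by case: _ / uv in vP *; rewrite (Prop_irrelevance uP vP).
Qed.

HB.instance Definition _ := gen_eqMixin (LspaceType mu p1).
HB.instance Definition _ := gen_choiceMixin (LspaceType mu p1).

Let add (u v : LspaceType mu p1) := Lclass (Lrepr u + Lrepr v).
Let opp (u : LspaceType mu p1) := Lclass (- Lrepr u).
Let scale (a : R) (u : LspaceType mu p1) := Lclass (a *: Lrepr u).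

Let addE u v : (add u v : T -> R) = (u : T -> R) \+ v %[ae mu].
Proof. exact: LclassE. Qed.
Let oppE u : (opp u : T -> R) = \- (u : T -> R) %[ae mu].
Proof. exact: LclassE. Qed.
Let scaleE a u : (scale a u : T -> R) = (fun x => a * u x) %[ae mu].
Proof. exact: LclassE. Qed.
Let zeroE : (Lclass 0 : T -> R) = (fun=> 0) %[ae mu].
Proof. exact: LclassE. Qed.

Let aeI (P Q : T -> Prop) : (\forall x \ae mu, P x) -> (\forall x \ae mu, Q x) ->
  \forall x \ae mu, P x /\ Q x.
Proof. by move=> HP HQ; apply: filterS2 HP HQ. Qed.

Let addA : associative add.
Proof.
move=> u v w; apply/Lspace_eqP.
have := aeI (aeI (addE u (add v w)) (addE v w))
                (aeI (addE (add u v) w) (addE u v)).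
move=> H; apply: filterS H => x [[/(_ I) e1 /(_ I) e2] [/(_ I) e3 /(_ I) e4]] _ /=.
by rewrite e1/= e2/= e3/= e4/= addrA.
Qed.

Let addC : commutative add.
Proof.
move=> u v; apply/Lspace_eqP; apply: filterS2 (addE u v) (addE v u) => x.
by move=> /(_ I) e1 /(_ I) e2 _ /=; rewrite e1/= e2/= addrC.
Qed.

Let add0 : left_id (Lclass 0) add.
Proof.
move=> u; apply/Lspace_eqP; apply: filterS2 (addE (Lclass 0) u) zeroE => x.
by move=> /(_ I) e1 /(_ I) e2 _ /=; rewrite e1/= e2/= add0r.
Qed.

Let addN : left_inverse (Lclass 0) opp add.
Proof.
move=> u; apply/Lspace_eqP; apply: filterS3 (addE (opp u) u) (oppE u) zeroE => x.
by move=> /(_ I) e1 /(_ I) e2 /(_ I) e3 _ /=; rewrite e1/= e2/= e3/= addNr.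
Qed.

HB.instance Definition _ :=
  GRing.isZmodule.Build (LspaceType mu p1) addA addC add0 addN.

Lemma LspaceD (u v : LspaceType mu p1) :
  ((u + v)%R : T -> R) = (fun x => u x + v x) %[ae mu].
Proof. exact: addE. Qed.

Let scaleA a b u : scale a (scale b u) = scale (a * b) u.
Proof.
apply/Lspace_eqP.
apply: filterS3 (scaleE a (scale b u)) (scaleE b u) (scaleE (a * b) u) => x.
by move=> /(_ I) e1 /(_ I) e2 /(_ I) e3 _ /=; rewrite e1/= e2/= e3/= mulrA.
Qed.

Let scale1 : left_id 1 scale.
Proof.
move=> u; apply/Lspace_eqP; apply: filterS (scaleE 1 u) => x.
by move=> /(_ I) e1 _ /=; rewrite e1/= mul1r.
Qed.

Let scaleDr : right_distributive scale +%R.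
Proof.
move=> a u v; apply/Lspace_eqP.
have := aeI (aeI (scaleE a (u + v)) (LspaceD u v))
  (aeI (LspaceD (scale a u) (scale a v)) (aeI (scaleE a u) (scaleE a v))).
move=> H; apply: filterS H => x [[/(_ I) e1 /(_ I) e2] [/(_ I) e3 [/(_ I) e4 /(_ I) e5]]] _ /=.
by rewrite e1/= e2/= e3/= e4/= e5/= mulrDr.
Qed.

Let scaleDl u : {morph scale^~ u : a b / a + b}.
Proof.
move=> a b; apply/Lspace_eqP.
have := aeI (scaleE (a + b) u)
  (aeI (LspaceD (scale a u) (scale b u)) (aeI (scaleE a u) (scaleE b u))).
move=> H; apply: filterS H => x [/(_ I) e1 [/(_ I) e2 [/(_ I) e3 /(_ I) e4]]] _ /=.
by rewrite e1/= e2/= e3/= e4/= mulrDl.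
Qed.

HB.instance Definition _ := GRing.Zmodule_isLmodule.Build R (LspaceType mu p1)
  scaleA scale1 scaleDr scaleDl.

Lemma LspaceZ a (u : LspaceType mu p1) :
  ((a *: u)%R : T -> R) = (fun x => a * u x) %[ae mu].
Proof. exact: scaleE. Qed.

Lemma Lspace0 : ((0 : LspaceType mu p1) : T -> R) = (fun=> 0) %[ae mu].
Proof. exact: zeroE. Qed.

Definition Lspace_norm (u : LspaceType mu p1) : R := fine 'N[mu]_p[EFin \o u]%E.

Let norm_ae (u : LspaceType mu p1) (f : LfunType mu p1) :
  (u : T -> R) = f %[ae mu] -> Lspace_norm u = fine 'N[mu]_p[EFin \o f]%E.
Proof.
move=> uf; congr fine; apply: eq_ae_Lnorm => //.
exact: measurable_Lspace.
Qed.

Let normD u v : Lspace_norm (u + v) <= Lspace_norm u + Lspace_norm v.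
Proof.
rewrite (@norm_ae (u + v) (Lrepr u + Lrepr v)); last exact: LspaceD.
exact: ler_LnormD.
Qed.

Let normZ a u : Lspace_norm (a *: u) = `|a| * Lspace_norm u.
Proof.
rewrite (@norm_ae (a *: u) (a *: Lrepr u)); last exact: LspaceZ.
by rewrite (LnormZ (Lrepr u)) fineM// -(finite_norm_fine (Lrepr u)).
Qed.

Let norm0_eq0 u : Lspace_norm u = 0 -> u = 0.
Proof.
move=> /(@fine_Lnormr_eq0 _ _ _ _ _ _ (Lrepr u)) u0; apply/Lspace_eqP.
by apply: filterS2 u0 Lspace0 => x /(_ I) e1 /(_ I) -> _.
Qed.

HB.instance Definition _ := Lmodule_isNormed.Build R (LspaceType mu p1)
  normD normZ norm0_eq0.

Lemma LspaceNormE (u : LspaceType mu p1) : `|u| = fine 'N[mu]_p[EFin \o u]%E.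
Proof. by []. Qed.

End Lspace_normed_module.


Section image_measure.
Local Open Scope ereal_scope.
Context d d' (T : measurableType d) (T' : measurableType d') (R : realType).
Variables (m : {measure set T -> \bar R}) (f : {mfun T >-> T'}).

Definition image_measure : set T' -> \bar R := pushforward m f.

Let im0 : image_measure set0 = 0. Proof. exact: measure0. Qed.

Let im_ge0 A : 0 <= image_measure A. Proof. exact: measure_ge0. Qed.

Let im_sigma_additive : semi_sigma_additive image_measure.
Proof.
move=> F mF tF mUF; rewrite /image_measure /pushforward preimage_bigcup.
apply: measure_semi_sigma_additive.
- by move=> n; rewrite -[X in measurable X]setTI; exact: measurable_funPT.
- apply/trivIsetP => /= i j _ _ ij; rewrite -preimage_setI.
  by move/trivIsetP : tF => /(_ _ _ _ _ ij) ->//; rewrite preimage_set0.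
- by rewrite -preimage_bigcup -[X in measurable X]setTI; exact: measurable_funPT.
Qed.

HB.instance Definition _ :=
  isMeasure.Build _ _ _ image_measure im0 im_ge0 im_sigma_additive.

End image_measure.

Section lebesgue_rV.
Context {R : realType}.
Local Notation TR := (measurableTypeR R).

Definition tuple_of_pair n (x : n.-tuple TR * TR) : n.+1.-tuple TR :=
  [tuple of x.2 :: x.1].

Lemma measurable_tuple_of_pair n : measurable_fun setT (@tuple_of_pair n).
Proof. exact: measurable_cons. Qed.

HB.instance Definition _ n :=
  isMeasurableFun.Build _ _ _ _ (@tuple_of_pair n) (@measurable_tuple_of_pair n).

(* The iterated product of the Lebesgue measure on R. *)
Fixpoint lebesgue_tuple n : {measure set (n.-tuple TR) -> \bar R} :=
  if n is n'.+1 then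
    image_measure (lebesgue_tuple n' \x lebesgue_measure)%E (@tuple_of_pair n')
  else \d_([tuple] : 0.-tuple TR).

Section borel_rV.
Variable n : nat.

Definition borel_rV : set (set 'rV[R]_n) := <<s @open 'rV[R]_n >>.

HB.instance Definition _ := @isMeasurable.Build default_measure_display
  'rV[R]_n borel_rV (@sigma_algebra0 _ _ _) (@sigma_algebraC _ _)
  (@sigma_algebra_bigcup _ _ _).

Lemma open_measurable_rV (U : set 'rV[R]_n) : open U -> measurable U.
Proof. exact: sub_sigma_algebra. Qed.

Definition row_of_tuple (t : n.-tuple TR) : 'rV[R]_n := \row_i tnth t i.

Lemma measurable_row_of_tuple : measurable_fun setT row_of_tuple.
Proof.
apply: (@measurability _ _ _ _ _ _ (@open 'rV[R]_n)) => // _ [U oU <-].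
rewrite setTI.
pose box (z : 'rV[rat]_n * nat) : set 'rV[R]_n :=
  [set x | forall i, ball (ratr (z.1 0 i) : R) z.2.+1%:R^-1 (x 0 i)].
have mbox z : measurable (row_of_tuple @^-1` box z).
  rewrite (_ : _ @^-1` _ = \big[setI/setT]_(i <- enum 'I_n)
      ((fun t : n.-tuple TR => tnth t i) @^-1` ball (ratr (z.1 0 i) : R) z.2.+1%:R^-1)).
    apply: bigsetI_measurable => i _; rewrite -[X in measurable X]setTI.
    by apply: measurable_tnth => //; exact: (@measurable_ball R).
  rewrite -bigcap_seq; apply/seteqP; split=> t /= tz i; last first.
    by have := tz i; rewrite /= mem_enum inE mxE; exact.
  by move=> _; have := tz i; rewrite mxE.
rewrite (_ : _ @^-1` U = \bigcup_z
    (if `[< box z `<=` U >] then row_of_tuple @^-1` box z else set0)).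
  by apply: countable_bigcupT_measurable => // z; case: ifP.
apply/seteqP; split=> [t /= Ut|t [z _]]; last by case: asboolP => // zU /zU.
have /nbhs_ballP[_/posnumP[e] eU] : nbhs (row_of_tuple t) U by exact: open_nbhs_nbhs.
have [k _ ke] : exists2 k, True & k.+1%:R^-1 < e%:num / 2 :> R.
  have : 0 < e%:num / 2 :> R by [].
  by move=> /ltr_add_invr[k]; rewrite add0r => ke; exists k.
have k0 : 0 < k.+1%:R^-1 :> R by rewrite invr_gt0.
have qP i : exists q : rat, ball (ratr q : R) k.+1%:R^-1 (tnth t i).
  have : tnth t i - k.+1%:R^-1 < tnth t i + k.+1%:R^-1 :> R.
    by rewrite ltrBlDr -addrA ltrDl addr_gt0.
  move=> /rat_in_itvoo[q]; rewrite in_itv/= => /andP[q1 q2]; exists q.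
  by rewrite /ball/= ltr_distl q1 q2.
have [q qt] := choice qP.
exists (\row_i q i, k) => //; case: asboolP => [_ i|]; first by rewrite /= !mxE.
case=> x /= xq; apply: eU; split=> // i0 i; rewrite ord1 mxE.
have := xq i; rewrite mxE => qx.
have tq : ball (tnth t i : R) (e%:num / 2) (ratr (q i)).
  by apply: ball_sym; apply: le_ball (qt i); exact: ltW.
by apply: (ball_split tq); apply: le_ball qx; exact: ltW.
Qed.

HB.instance Definition _ :=
  isMeasurableFun.Build _ _ _ _ row_of_tuple measurable_row_of_tuple.

Definition lebesgue_rV : {measure set 'rV[R]_n -> \bar R} :=
  image_measure (lebesgue_tuple n) row_of_tuple.

End borel_rV.
End lebesgue_rV.

Section lebesgue_on.
Context {R : realType} {d : nat} {Omega : set 'rV[R]_d}.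

(* The Lebesgue measure restricted to Omega; functions are total on R^d, and
   their values off Omega are irrelevant up to a.e. equality. *)
Definition lebesgue_on (oOmega : open Omega) : {measure set 'rV[R]_d -> \bar R} :=
  mrestr (@lebesgue_rV R d) (open_measurable_rV oOmega).

Definition L2 (oOmega : open Omega) := LspaceType2 (lebesgue_on oOmega).

End lebesgue_on.

Section semismooth.
Context {R : realType} {X Z : normedModType R}.

Definition bounded_operator (M : X -> Z) :=
  exists C : R, forall x, `|M x| <= C * `|x|.

(* The supremum is taken in \bar R; it is -oo over an empty family, which the
   nonemptiness requirement rules out. *)
Definition semismooth (G : X -> Z) (dG : X -> set {linear X -> Z}) (order : R) :=
  [/\ continuous G,
      forall v, dG v !=set0,
      forall v (M : {linear X -> Z}), dG v M -> bounded_operator M &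
      forall v, exists C : R, \forall s \near (0 : X),
        (ereal_sup [set `|G (v + s) - G v - M s|%:E | M in dG (v + s)]%R
           <= (C * `|s| `^ (1 + order))%:E)%E].

End semismooth.

Section projection.
Context {R : realType}.

Definition proj (a b x : R) : R := Num.max a (Num.min b x).

Definition dproj (a b x : R) : set R :=
  if a < x < b then [set 1]
  else if (x == a) || (x == b) then `[0, 1]%classic
  else [set 0].

End projection.

Section finite_elements.
Context {R : realType} {d : nat}.
Implicit Types (Omega A : set 'rV[R]_d) (v : 'rV[R]_d -> R).

Definition dotv (x y : 'rV[R]_d) : R := \sum_(i < d) x 0 i * y 0 i.

(* Classical gradient.  It is used below for functions that are affine on each
   simplex of a partition; it is then defined off the boundaries of the simplices,
   hence a.e., and it agrees there with the weak gradient. *)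
Definition grad v (x : 'rV[R]_d) : 'rV[R]_d := \row_(i < d) 'D_(delta_mx 0 i) v x.

Definition convex_hull A : set 'rV[R]_d :=
  [set x | exists (n : nat) (p : 'I_n -> 'rV[R]_d) (t : 'I_n -> R),
    [/\ forall i, A (p i), forall i, 0 <= t i, \sum_(i < n) t i = 1 &
        x = \sum_(i < n) t i *: p i]].

Definition affinely_independent n (p : 'I_n -> 'rV[R]_d) :=
  forall t : 'I_n -> R, \sum_(i < n) t i = 0 -> \sum_(i < n) t i *: p i = 0 ->
  forall i, t i = 0.

(* The closed simplex with vertices p 0, ..., p d. *)
Definition simplex (p : 'I_d.+1 -> 'rV[R]_d) : set 'rV[R]_d :=
  convex_hull (range p).

Definition polyhedral_domain Omega :=
  [/\ open Omega, bounded_set Omega, (closure Omega)° = Omega &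
      exists (n : nat) (p : 'I_n -> 'I_d.+1 -> 'rV[R]_d),
        (forall j, affinely_independent (p j)) /\
        closure Omega = \bigcup_j simplex (p j)].

(* T j lists the vertices of the j-th simplex.  Two simplices meet in the common
   face spanned by the vertices that they share, possibly the empty face. *)
Definition admissible_partition Omega nt (T : 'I_nt -> 'I_d.+1 -> 'rV[R]_d) :=
  [/\ forall j, affinely_independent (T j),
      closure Omega = \bigcup_j simplex (T j),
      forall j k, j != k -> (simplex (T j))° `&` (simplex (T k))° = set0 &
      forall j k, simplex (T j) `&` simplex (T k) =
                  convex_hull (range (T j) `&` range (T k))].

Section spaces.
Variables (Omega : set 'rV[R]_d) (nt : nat) (T : 'I_nt -> 'I_d.+1 -> 'rV[R]_d).

(* Elements of W_h and Y_h are represented by total functions of which only the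
   values on closure Omega matter. *)
Definition W_h v :=
  {within closure Omega, continuous v} /\
  forall j, exists (c : 'rV[R]_d) (c0 : R),
    forall x, simplex (T j) x -> v x = dotv c x + c0.

Definition Y_h v :=
  W_h v /\ forall x, (closure Omega `\` Omega°) x -> v x = 0.

End spaces.
End finite_elements.

Section control_problem.
Context {R : realType} {d : nat} {Omega : set 'rV[R]_d} (oOmega : open Omega).
Local Notation mu := (lebesgue_on oOmega).
Local Notation L2 := (L2 oOmega).

(* S f is the class of a function y of Y_h that solves the Galerkin equations. *)
Definition discrete_solution_operator nt (T : 'I_nt -> 'I_d.+1 -> 'rV[R]_d)
    (S : L2 -> L2) :=
  forall f : L2, exists y : 'rV[R]_d -> R,
    [/\ Y_h Omega T y,
        (S f : 'rV[R]_d -> R) = y %[ae mu] &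
        forall v, Y_h Omega T v ->
          \int[mu]_x dotv (grad y x) (grad v x) = \int[mu]_x (f x * v x)].

Definition adjoint_operator (S S' : L2 -> L2) :=
  forall f g : L2, \int[mu]_x (S f x * g x) = \int[mu]_x (f x * S' g x).

Variables (S S' : L2 -> L2) (z : L2) (alpha : R) (a b : 'rV[R]_d -> R).

Definition y_h (v : L2) : L2 := S v.

Definition p_h (y : L2) : L2 := S' (y - z).

(* Equality in L^2 is a.e. equality, so this determines G. *)
Definition is_G_h (G : L2 -> L2) := forall v : L2,
  (G v : 'rV[R]_d -> R) =
    (fun x => v x - proj (a x) (b x) (- (alpha^-1 * p_h (y_h v) x))) %[ae mu].

Definition dG_h (v : L2) : set {linear L2 -> L2} :=
  [set M : {linear L2 -> L2} | bounded_operator M /\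
    exists g : 'rV[R]_d -> R,
      [/\ g \in Lfun mu +oo%E,
          \forall x \ae mu,
            dproj (a x) (b x) (- (alpha^-1 * p_h (y_h v) x)) (g x) &
          forall w : L2, (M w : 'rV[R]_d -> R) =
            (fun x => w x + alpha^-1 * (g x * S' (S w) x)) %[ae mu]]].

End control_problem.

(* Main.v *)
(* By the symmetry of the Galerkin equations [Sh' = Sh], hence [Sh] is linear;
   its range is finite-dimensional, so [Sh (Sh s)] is bounded in the sup norm by
   a multiple of the L^2 norm of [s].  Put [q v = - alpha^-1 Sh (Sh v - z)] and
   [t = q (v + s) - q v].  The Newton remainder is, up to the sign,
   [P (q v + t) - P (q v) - g t], which is pointwise at most [`|t|] and vanishes
   unless [0 < `|q v - a| <= `|t|] or [0 < `|q v - b| <= `|t|].  Since [q v - a]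
   and [q v - b] are piecewise affine, these sets are contained in finitely many
   strips of width [O(sup `|t|)] off the zero set of an affine function, so the
   L^2 norm of the remainder is [O(`|s| ^ (3/2))]. *)

Require Import Defs.
From HB Require Import structures.
From mathcomp Require Import all_boot all_order all_algebra.
From mathcomp Require Import all_classical all_reals all_analysis.
From mathcomp Require Import measurable_realfun ess_sup_inf ring lra.

Set Implicit Arguments.
Unset Strict Implicit.
Unset Printing Implicit Defensive.
Import Order.TTheory GRing.Theory Num.Theory.
Import numFieldNormedType.Exports.

Local Open Scope classical_set_scope.
Local Open Scope ring_scope.

(** * The inner product of L^2 *)

Section L2_space.
Context d (T : measurableType d) (R : realType).
Variable mu : {measure set T -> \bar R}.
Local Notation L2 := (LspaceType2 mu).
Implicit Types u v w : L2.

Lemma ae_and (P Q : T -> Prop) : (\forall x \ae mu, P x) ->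
  (\forall x \ae mu, Q x) -> \forall x \ae mu, P x /\ Q x.
Proof. exact: filterI. Qed.

Lemma ae_imply (P Q : T -> Prop) : (\forall x \ae mu, P x) ->
  (forall x, P x -> Q x) -> \forall x \ae mu, Q x.
Proof. by move=> muP PQ; exact: filterS muP. Qed.

Lemma Lspace_ae_eq u v : (\forall x \ae mu, u x = v x) -> u = v.
Proof. by move=> uv; apply/Lspace_eqP; apply: filterS uv => x -> . Qed.

Lemma Lspace_aeD u v : \forall x \ae mu, (u + v) x = u x + v x.
Proof. by apply: filterS (LspaceD u v) => x /(_ I). Qed.

Lemma Lspace_aeZ k u : \forall x \ae mu, (k *: u) x = k * u x.
Proof. by apply: filterS (LspaceZ k u) => x /(_ I). Qed.

Lemma Lspace_ae0 : \forall x \ae mu, (0 : L2) x = 0.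
Proof. by apply: filterS (Lspace0 mu (lee1n 2)) => x /(_ I). Qed.

Lemma Lspace_aeB u v : \forall x \ae mu, (u - v) x = u x - v x.
Proof.
apply: filterS2 (Lspace_aeD u (- v)) (Lspace_aeZ (-1) v) => x ->.
by rewrite scaleN1r mulN1r => ->.
Qed.

Lemma Lspace_ae_sum n (u : 'I_n -> L2) :
  \forall x \ae mu, (\sum_i u i) x = \sum_i u i x.
Proof.
elim: n u => [|n IH] u.
  by rewrite big_ord0; apply: filterS Lspace_ae0 => x ->; rewrite big_ord0.
rewrite big_ord_recl.
apply: filterS2 (Lspace_aeD (u ord0) (\sum_i u (lift ord0 i)))
  (IH (fun i => u (lift ord0 i))) => x -> ->.
by rewrite big_ord_recl.
Qed.

Lemma measurable_L2 u : measurable_fun setT (u : T -> R).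
Proof. exact: measurable_Lspace. Qed.

Lemma L2_Lfun u : (u : T -> R) \in Lfun mu 2%:E.
Proof.
rewrite inE; apply/andP; split; rewrite inE/=; first exact: measurable_L2.
exact: Lebesgue_finite.
Qed.

Lemma Lfun_L2 (f : T -> R) : f \in Lfun mu 2%:E ->
  exists u : L2, \forall x \ae mu, u x = f x.
Proof.
move=> ff; exists (Lclass (Lfun_Sub (lee1n 2) ff)).
by apply: filterS (LclassE (Lfun_Sub (lee1n 2) ff)) => x /(_ I).
Qed.

Lemma le_Lfun2 (f g : T -> R) : measurable_fun setT f -> g \in Lfun mu 2%:E ->
  (\forall x \ae mu, `|f x| <= `|g x|) -> f \in Lfun mu 2%:E.
Proof.
move=> mf gg fg; have : (\int[mu]_x (g x ^+ 2)%:E < +oo)%E.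
  exact/integrable_lty/Lfun2_integrable_sqr.
have mg : measurable_fun setT g by move: gg; rewrite inE => /andP[/[!inE]].
move=> gfin; rewrite inE; apply/andP; split; rewrite inE//=.
rewrite /finite_norm unlock poweR_lty//; apply: le_lt_trans gfin.
apply: ae_ge0_le_integral => //.
- by move=> x _; exact: poweR_ge0.
- apply: (@measurableT_comp _ _ _ _ _ _ (fun x : \bar R => (x `^ 2)%E)).
    exact: measurable_poweR.
  by apply: measurableT_comp => //; exact/measurable_EFinP.
- by move=> x _; rewrite lee_fin sqr_ge0.
- exact/measurable_EFinP/measurable_funX.
- apply: filterS fg => x fgx _ /=; rewrite lee_fin powR_mulrn//.
  by rewrite -(real_normK (num_real (g x))) ler_sqr ?nnegrE.
Qed.

Definition dot u v : R := \int[mu]_x (u x * v x).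

Lemma integrable_mul u v : mu.-integrable setT (EFin \o (fun x => u x * v x)).
Proof.
apply/Lfun1_integrable; apply: Lfun2_mul_Lfun1; exact: L2_Lfun.
Qed.

Lemma ae_eq_Rintegral (f g : T -> R) : measurable_fun setT f ->
  measurable_fun setT g -> (\forall x \ae mu, f x = g x) ->
  \int[mu]_x f x = \int[mu]_x g x.
Proof.
move=> mf mg fg; congr fine; apply: ae_eq_integral => //; try exact/measurable_EFinP.
by apply: filterS fg => x -> _.
Qed.

Lemma dotC u v : dot u v = dot v u.
Proof. by apply: eq_Rintegral => x _; rewrite mulrC. Qed.

Lemma dotDl u v w : dot (u + v) w = dot u w + dot v w.
Proof.
rewrite /dot -RintegralD//; try exact: integrable_mul.
apply: ae_eq_Rintegral.
- by apply: measurable_funM; exact: measurable_L2.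
- by apply: measurable_funD; apply: measurable_funM; exact: measurable_L2.
- by apply: filterS (Lspace_aeD u v) => x ->; rewrite mulrDl.
Qed.

Lemma dotZl k u w : dot (k *: u) w = k * dot u w.
Proof.
rewrite /dot -RintegralZl//; last exact: integrable_mul.
apply: ae_eq_Rintegral.
- by apply: measurable_funM; exact: measurable_L2.
- by apply: measurable_funM => //; apply: measurable_funM; exact: measurable_L2.
- by apply: filterS (Lspace_aeZ k u) => x ->; rewrite mulrA.
Qed.

Lemma dot_suml n (u : 'I_n -> L2) w : dot (\sum_i u i) w = \sum_i dot (u i) w.
Proof.
elim: n u => [|n IH] u; last by rewrite !big_ord_recl dotDl IH.
by rewrite !big_ord0 -(scale0r (0 : L2)) dotZl mul0r.
Qed.

Lemma dot_sumr n (u : 'I_n -> L2) w : dot w (\sum_i u i) = \sum_i dot w (u i).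
Proof. by rewrite dotC dot_suml; apply: eq_bigr => i _; rewrite dotC. Qed.

Lemma dotZr k u w : dot w (k *: u) = k * dot w u.
Proof. by rewrite dotC dotZl (dotC w). Qed.

Lemma L2_norm_fin u : (`|u|%:E = 'N[mu]_2%:E[EFin \o u])%E.
Proof. by rewrite LspaceNormE (finite_norm_fine (Lrepr u)). Qed.

Lemma dotuu u : dot u u = `|u| ^+ 2.
Proof.
apply/EFin_inj; rewrite -powR_mulrn// -poweR_EFin L2_norm_fin powR_Lnorm//.
rewrite /dot /Rintegral fineK; last first.
  exact/integrable_fin_num/integrable_mul.
by apply: eq_integral => x _; rewrite /= powR_mulrn// real_normK ?num_real.
Qed.

Lemma cauchy_schwarz u v : `|dot u v| <= `|u| * `|v|.
Proof.
rewrite -lee_fin EFinM !L2_norm_fin.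
have h : 2^-1 + 2^-1 = 1 :> R by rewrite [RHS]splitr !div1r.
apply: le_trans (hoelder mu (measurable_L2 u) (measurable_L2 v) _ _ h) => //.
rewrite EFin_normr_Rintegral//; last exact: integrable_mul.
rewrite Lnorm1; apply: le_abse_integral => //.
by have /integrableP[] := integrable_mul u v.
Qed.

(** The right side is an extended integral, so the bound makes sense for an [f] that is not known to
    be square integrable. *)
Lemma L2_normsq_le u (f : T -> R) : measurable_fun setT f ->
  (\forall x \ae mu, `|u x| <= f x) ->
  ((`|u| ^+ 2)%:E <= \int[mu]_x (f x ^+ 2)%:E)%E.
Proof.
move=> mf uf; rewrite -dotuu /dot /Rintegral fineK; last first.
  exact/integrable_fin_num/integrable_mul.
have mu2 := measurable_L2 u.
apply: ae_ge0_le_integral => //.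
- by move=> x _; rewrite lee_fin -expr2 sqr_ge0.
- by apply/measurable_EFinP; exact: measurable_funM.
- by move=> x _; rewrite lee_fin sqr_ge0.
- by apply/measurable_EFinP; exact: measurable_funX.
- apply: filterS uf => x ux _; rewrite lee_fin -expr2 -[X in X <= _]real_normK ?num_real//.
  by rewrite lerXn2r// nnegrE (le_trans _ ux).
Qed.

Lemma L2_norm_le u v (k : R) : 0 <= k ->
  (\forall x \ae mu, `|u x| <= k * `|v x|) -> `|u| <= k * `|v|.
Proof.
move=> k0 uv; rewrite -ler_sqr ?nnegrE ?mulr_ge0//.
rewrite exprMn -(dotuu v) -lee_fin.
apply: le_trans (@L2_normsq_le u (fun x => k * `|v x|) _ uv) _.
  by apply: measurable_funM => //; apply: measurableT_comp => //; exact: measurable_L2.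
under eq_integral do rewrite exprMn real_normK ?num_real// EFinM.
rewrite integralZl//; last by apply: Lfun2_integrable_sqr; exact: L2_Lfun.
rewrite (EFinM _ (dot v v)) lee_wpmul2l// ?lee_fin ?sqr_ge0// /dot /Rintegral fineK.
  by under [leRHS]eq_integral do rewrite -expr2.
exact/integrable_fin_num/integrable_mul.
Qed.

(** Here the order of the remainder is gained: a height and a support measure both of order [|s|]
    make the squared norm cubic in [|s|]. *)
Lemma L2_norm_le_indic u (A : set T) (k m : R) : measurable A ->
  (mu A <= m%:E)%E -> (\forall x \ae mu, `|u x| <= k * \1_A x) ->
  `|u| ^+ 2 <= k ^+ 2 * m.
Proof.
move=> mA Am uA; rewrite -lee_fin.
apply: le_trans (L2_normsq_le _ uA) _; first exact: measurable_funM.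
under eq_integral => x _.
  rewrite exprMn EFinM (_ : \1_A x ^+ 2 = \1_A x); last first.
    by rewrite indicE; case: (_ \in _); rewrite ?expr1n ?expr0n.
  over.
rewrite ge0_integralZl//; last first.
- by rewrite lee_fin sqr_ge0.
- exact: measurableT_comp.
by rewrite integral_indic// setIT (EFinM _ m) lee_wpmul2l// lee_fin sqr_ge0.
Qed.

End L2_space.

(** * Self-adjoint operators of finite rank on L^2 *)

Section finite_rank_operator.
Context d (T : measurableType d) (R : realType).
Variable mu : {measure set T -> \bar R}.
Local Notation L2 := (LspaceType2 mu).
Implicit Types (u v w : L2) (S : L2 -> L2).

Lemma dot_inj u v : (forall w, dot u w = dot v w) -> u = v.
Proof.
move=> uv; apply/eqP; rewrite -subr_eq0 -normr_eq0 -sqrf_eq0 -dotuu.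
by rewrite dotDl uv -dotDl subrr -(scale0r (0 : L2)) dotZl mul0r.
Qed.

(** Moving [S] to the other argument leaves an expression linear in the first one, and the pairing
    separates points. *)
Lemma adjoint_linear S S' : (forall u v, dot (S u) v = dot u (S' v)) -> linear S.
Proof.
move=> SS' k u v; apply: dot_inj => w.
by rewrite SS' !dotDl !dotZl !SS'.
Qed.

(* The coordinates of [S u] are recovered from the numbers
   [dot (S u) (e j) = dot u (S (e j))], which are bounded in [u], through a
   generalized inverse of the Gram matrix of [e]; so [e] need not be free. *)
Lemma self_adjoint_coord_bound n (e : 'I_n -> L2) S :
  (forall u v, dot (S u) v = dot u (S v)) ->
  (forall u, exists c : 'I_n -> R, S u = \sum_i c i *: e i) ->
  exists2 C : R, 0 <= C & forall u, exists2 c : 'I_n -> R,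
    S u = \sum_i c i *: e i & forall i, `|c i| <= C * `|u|.
Proof.
move=> Ssym Sspan.
pose K : 'M[R]_n := \matrix_(i, j) dot (e i) (e j).
exists (\sum_i \sum_j `|S (e j)| * `|pinvmx K j i|).
  by apply: sumr_ge0 => i _; apply: sumr_ge0 => j _; rewrite mulr_ge0.
move=> u; have [c Su] := Sspan u.
pose r : 'rV[R]_n := \row_i c i.
pose b : 'rV[R]_n := \row_j dot u (S (e j)).
have rK (x : 'rV[R]_n) j : (x *m K) 0 j = dot (\sum_i x 0 i *: e i) (e j).
  by rewrite mxE dot_suml; apply: eq_bigr => i _; rewrite mxE dotZl.
have bE : b = r *m K.
  apply/rowP => j; rewrite rK [LHS]mxE -Ssym Su.
  by under [in RHS]eq_bigr do rewrite mxE.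
pose c' := b *m pinvmx K.
have cK : (c' - r) *m K = 0.
  by rewrite mulmxBl mulmxKpV ?bE ?submxMl// subrr.
exists (fun i => c' 0 i) => [|i].
  (* Coefficients with the same image under the Gram matrix give the same element: their difference
     yields a vector orthogonal to every [e j], hence to itself. *)
  suff e0 : \sum_i (c' - r) 0 i *: e i = 0.
    apply/esym/eqP; rewrite Su -subr_eq0 -sumrB -[X in _ == X]e0; apply/eqP.
    by apply: eq_bigr => i _; rewrite -scalerBl !mxE.
  apply/eqP; rewrite -normr_eq0 -sqrf_eq0 -dotuu dot_sumr big1// => j _.
  by rewrite dotZr -rK cK [X in _ * X]mxE mulr0.
rewrite mxE (le_trans (ler_norm_sum _ _ _))//.
(* The constant sums over all rows in order to be uniform in [i]; only its [i]-th row is used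
   here. *)
rewrite [X in _ <= X * _](bigD1 i)//= mulrDl.
rewrite ler_wpDr ?mulr_ge0//.
  by apply: sumr_ge0 => k _; apply: sumr_ge0 => j _; rewrite mulr_ge0.
rewrite mulr_suml; apply: ler_sum => j _; rewrite normrM mxE mulrAC.
by rewrite ler_wpM2r// mulrC cauchy_schwarz.
Qed.

End finite_rank_operator.

(** * Semismoothness of the projection *)

Section pointwise_projection.
Context {R : realType}.
Local Notation proj := Defs.proj.
Implicit Types a b x y g t : R.

(** The cases overlap at the bounds, and each gives linear facts only, so that later case splits end
    in linear arithmetic. *)
Lemma proj_cases a b x : a <= b ->
  [\/ x <= a /\ proj a b x = a, b <= x /\ proj a b x = b |
      a <= x <= b /\ proj a b x = x].
Proof.
move=> ab; rewrite /proj; have [bx|xb] := leP b x.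
  by apply: Or32; rewrite max_r.
have [ax|xa] := leP a x; first by apply: Or33; split; rewrite ?ax ?ltW.
by apply: Or31; split; rewrite ?ltW.
Qed.

Lemma proj_norm_le a b x : a <= b -> `|proj a b x| <= `|a| + `|b|.
Proof.
move=> ab; case: (proj_cases x ab) => -[h ->]; rewrite ?lerDl ?lerDr//.
have := ler_norm (- a); have := ler_norm b; have := normr_ge0 a.
have := normr_ge0 b; rewrite normrN ler_norml.
by move: h => /andP[? ?] ? ? ? ?; apply/andP; split; lra.
Qed.

Lemma proj_low a b x : a <= b -> x <= a -> proj a b x = a.
Proof. by move=> ab xa; case: (proj_cases x ab) => -[? ->]; lra. Qed.

Lemma proj_high a b x : a <= b -> b <= x -> proj a b x = b.
Proof. by move=> ab xa; case: (proj_cases x ab) => -[? ->]; lra. Qed.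

Lemma proj_mid a b x : a <= b -> a <= x <= b -> proj a b x = x.
Proof. by move=> ab xa; case: (proj_cases x ab) => -[? ->]; lra. Qed.

Lemma dproj_cases a b x g : a < b -> dproj a b x g ->
  [\/ (x < a \/ b < x) /\ g = 0, a < x < b /\ g = 1 |
      (x = a \/ x = b) /\ 0 <= g <= 1].
Proof.
move=> ab; rewrite /dproj; case: ifPn => [axb ->|]; first exact: Or32.
rewrite negb_and -!leNgt => /orP xab; case: ifPn => [/orP|].
  by rewrite /= in_itv/= => -[] /eqP xE g01; apply: Or33; split=> //; [left|right].
rewrite negb_or => /andP[xa xb] ->; apply: Or31; split=> //.
by case: xab => h; [left|right]; rewrite lt_neqAle ?h ?andbT// eq_sym.
Qed.

Lemma proj_lipschitz a b x y : a <= b -> `|proj a b x - proj a b y| <= `|x - y|.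
Proof.
move=> ab; have h := ler_norm (x - y); have := ler_norm (- (x - y)).
rewrite normrN => h'; rewrite ler_norml.
by case: (proj_cases x ab) => -[? ->]; case: (proj_cases y ab) => -[? ->]; lra.
Qed.

(* No smallness of [t] is needed: if [x = a] and [b - a <= `|t|] then [x] lies
   in the exceptional set around [b], and symmetrically. *)
Lemma dproj_remainder0 a b x t g : a < b -> dproj a b (x + t) g ->
  ~ (0 < `|x - a| <= `|t| \/ 0 < `|x - b| <= `|t|) ->
  proj a b (x + t) - proj a b x - g * t = 0.
Proof.
move=> ab dg nE.
(* A bound [c] other than [x] is farther from [x] than [|t|], so [x + t] and [x - t] are on the same
   side of it; their midpoint [x] is then there as well. *)
have far c : c = a \/ c = b ->
    [\/ x = c, x + t < c /\ x - t < c | c < x + t /\ c < x - t].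
  move=> cab; have [->|xc] := eqVneq x c; first exact: Or31.
  have : `|t| < `|x - c|.
    rewrite ltNge; apply/negP => h; apply: nE.
    by case: cab => e; [left|right]; rewrite -e h normr_gt0 subr_eq0 xc.
  rewrite ltr_norml; have [h|h] := ltP (x - c) 0 => /andP[tx1 tx2].
    by apply: Or32; move: tx1 tx2; rewrite ltr0_norm//; lra.
  by apply: Or33; move: tx1 tx2; rewrite ger0_norm//; lra.
have fa := far a (or_introl erefl); have fb := far b (or_intror erefl).
case: (dproj_cases ab dg) => {dg}-[].
- move=> h ->; rewrite mul0r subr0; apply/eqP; rewrite subr_eq0; apply/eqP.
  case: h => h.
    have xa : x <= a by case: fa => ?; lra.
    by rewrite !(proj_low (ltW ab)) ?(ltW h).
  have bx : b <= x by case: fb => ?; lra.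
  by rewrite !(proj_high (ltW ab)) ?(ltW h).
- move=> /andP[h1 h2] ->.
  have ax : a <= x by case: fa => ?; lra.
  have xb : x <= b by case: fb => ?; lra.
  by rewrite !(proj_mid (ltW ab)) ?ax ?(ltW h1) ?(ltW h2)//; ring.
(* If [x + t] is itself a bound, the two strict alternatives of [far] are excluded for it, so [x] is
   the same bound. *)
- move=> h _; have -> : t = 0.
    by case: h => h; [case: fa => ?; lra|case: fb => ?; lra].
  by rewrite addr0 mulr0 subrr subr0.
Qed.

(** The increment of the projection and [g * t] both lie between [0] and [t], so their difference is
    at most [|t|]. *)
Lemma dproj_remainder_le a b x t g : a < b -> dproj a b (x + t) g ->
  `|proj a b (x + t) - proj a b x - g * t| <= `|t|.
Proof.
move=> ab dg.
have /andP[g0 g1] : 0 <= g <= 1.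
  by case: (dproj_cases ab dg) => -[_ //] ->; rewrite ?lexx ?ler01.
suff: 0 <= t /\ 0 <= proj a b (x + t) - proj a b x <= t \/
      t <= 0 /\ t <= proj a b (x + t) - proj a b x <= 0.
  move: (_ - _) => p; rewrite ler_norml => -[] [t0 /andP[p0 p1]].
    have := mulr_ge0 g0 t0; have := ler_piMl t0 g1.
    by rewrite ger0_norm// => gt1 gt0; apply/andP; split; lra.
  have := mulr_ge0_le0 g0 t0; have := ler_niMl t0 g1.
  by rewrite ler0_norm// => gt1 gt0; apply/andP; split; lra.
have [t0|t0] := leP 0 t; [left|right]; split; rewrite ?(ltW t0)//.
  by case: (proj_cases x (ltW ab)) => -[? ->];
    case: (proj_cases (x + t) (ltW ab)) => -[? ->]; lra.
by case: (proj_cases x (ltW ab)) => -[? ->];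
   case: (proj_cases (x + t) (ltW ab)) => -[? ->]; lra.
Qed.

End pointwise_projection.

(** * Semismoothness from a cubic bound on the squared remainder *)

Section lipschitz_semismooth.
Context (R : realType) (X Z : normedModType R).

(** On []0, 1]] powers decrease in the exponent, and [2 * (1 + mu') <= 3]; the base [0] is treated
    apart. *)
Lemma powR_ge_expr (x mu' : R) : 0 <= x <= 1 -> 0 < mu' -> mu' < 3^-1 ->
  x ^+ 3 <= (x `^ (1 + mu')) ^+ 2.
Proof.
move=> /andP[x0 x1] m0 m3; have [->|xn0] := eqVneq x 0.
  by rewrite expr0n/= sqr_ge0.
have xp : 0 < x by rewrite lt_neqAle eq_sym xn0.
rewrite -!powR_mulrn ?powR_ge0// -powRrM ger_powR ?xp//.
by lra.
Qed.

(** The bound on the square gives a remainder of order [3/2], which is at least [1 + mu]; this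
    suffices for [|s| <= 1]. Continuity follows from the Lipschitz bound. *)
Lemma lipschitz_semismooth (G : X -> Z) (dG : X -> set {linear X -> Z})
    (mu : R) : 0 < mu -> mu < 3^-1 ->
  (exists C : R, forall v s, `|G (v + s) - G v| <= C * `|s|) ->
  (forall v, dG v !=set0) ->
  (forall v M, dG v M -> bounded_operator M) ->
  (forall v, exists K : R, forall s (M : {linear X -> Z}), dG (v + s) M ->
     `|G (v + s) - G v - M s| ^+ 2 <= K * `|s| ^+ 3) ->
  semismooth G dG mu.
Proof.
move=> m0 m3 [C CP] dG0 dGb rem; split => //.
- move=> v; apply/cvgrPdist_le => eps eps0; near=> w.
  rewrite -(subrK v w) (addrC _ v) distrC (le_trans (CP _ _))//.
  have : `|v - w| <= eps / (`|C| + 1).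
    by near: w; apply: (@cvgr_dist_le _ _ _ _ _ id v) => //;
      rewrite divr_gt0// ltr_wpDl.
  rewrite distrC ler_pdivlMr ?ltr_wpDl// => h; apply: le_trans h.
  rewrite mulrC ler_wpM2l// (le_trans (ler_norm _))// lerDl//.
- move=> v; have [K KP] := rem v.
  exists (Num.sqrt `|K|); near=> s; apply: ge_ereal_sup => _ [M dM <-].
  rewrite lee_fin -ler_sqr ?nnegrE ?mulr_ge0 ?sqrtr_ge0 ?powR_ge0//.
  rewrite (le_trans (KP s M dM))// exprMn sqr_sqrtr//.
  rewrite (le_trans (ler_wpM2r (exprn_ge0 _ (normr_ge0 _)) (ler_norm K)))//.
  rewrite ler_wpM2l//; apply: powR_ge_expr => //; rewrite normr_ge0/=.
  have : `|0 - s| <= 1.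
    by near: s; apply: (@cvgr_dist_le _ _ _ _ _ id 0).
  by rewrite sub0r normrN.
Unshelve. all: by end_near.
Qed.

End lipschitz_semismooth.

(** * The Newton remainder when the range of [S] and the bounds lie in a finite-dimensional span *)

Section abstract_semismoothness.
Context (R : realType) (d : nat) (Omega : set 'rV[R]_d) (oOmega : open Omega).
Local Notation mu := (lebesgue_on oOmega).
Local Notation L2 := (L2 oOmega).
Local Notation proj := Defs.proj.
Context (S : L2 -> L2) (z : L2) (alpha : R) (a b : 'rV[R]_d -> R).
Context (n : nat) (e : 'I_n -> 'rV[R]_d -> R) (B : R).

Let lin (c : 'I_n -> R) x := \sum_i c i * e i x.

Context (alpha0 : 0 < alpha).
Context (Ssym : forall u v : L2, dot (S u) v = dot u (S v)).
Context (me : forall i, measurable_fun setT (e i)).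
Context (e2 : forall i, e i \in Lfun mu 2%:E).
Context (eB : forall i x, `|e i x| <= B).
Context (Sspan : forall u, exists c, \forall x \ae mu, S u x = lin c x).
Context (ca cb : 'I_n -> R).
Context (aE : \forall x \ae mu, a x = lin ca x).
Context (bE : \forall x \ae mu, b x = lin cb x).
Context (ab : \forall x \ae mu, a x < b x).
(** The geometric input: strips around a zero set have measure linear in their width. The zero set
    itself is removed, since [lin c] may vanish on a set of positive measure. *)
Context (sublevel_lin : forall c, exists2 K : R, 0 <= K &
  forall t : R, 0 <= t -> (mu [set x | (0 < `|lin c x| <= t)%R] <= (K * t)%:E)%E).

Lemma measurable_lin c : measurable_fun setT (lin c).
Proof. by apply: measurable_sum => i; apply: measurable_funM. Qed.

Lemma lin_L2 : exists E : 'I_n -> L2,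
  forall c, \forall x \ae mu, (\sum_i c i *: E i) x = lin c x.
Proof.
have [E EE] := choice (fun i => Lfun_L2 (e2 i)); exists E => c.
have h1 : \forall x \ae mu, forall i, E i x = e i x by apply: filter_forall => i.
have h2 : \forall x \ae mu, forall i, (c i *: E i) x = c i * E i x.
  by apply: filter_forall => i; exact: Lspace_aeZ.
apply: filterS3 h1 h2 (Lspace_ae_sum (fun i => c i *: E i)) => x e1 e2' ->.
by apply: eq_bigr => i _; rewrite e2' e1.
Qed.

Lemma lin_Lfun2 c : lin c \in Lfun mu 2%:E.
Proof.
have [E EE] := lin_L2.
apply: (le_Lfun2 (measurable_lin c) (L2_Lfun (\sum_i c i *: E i))).
by apply: filterS (EE c) => x ->.
Qed.

Lemma lin_sub c c' x : lin c x - lin c' x = lin (fun i => c i - c' i) x.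
Proof. by rewrite /lin -sumrB; apply: eq_bigr => i _; rewrite mulrBl. Qed.

Lemma S_linear : linear S.
Proof. exact: adjoint_linear Ssym. Qed.

Lemma S_D u v : S (u + v) = S u + S v.
Proof. by rewrite -[u in LHS]scale1r S_linear scale1r. Qed.

(** The coefficients of [S u] are controlled by the norm of [u], and each [e i] has a finite L^2
    norm and a finite sup norm. One constant serves both bounds; this is how an L^2 norm comes to
    control a pointwise value. *)
Lemma S_bound : exists2 C : R, 0 <= C & forall u : L2,
  `|S u| <= C * `|u| /\ \forall x \ae mu, `|S u x| <= C * `|u|.
Proof.
have [E EE] := lin_L2.
have Sspan' u : exists c : 'I_n -> R, S u = \sum_i c i *: E i.
  have [c cP] := Sspan u; exists c; apply: Lspace_ae_eq.
  by apply: filterS2 cP (EE c) => x -> ->.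
have [C C0 CP] := self_adjoint_coord_bound Ssym Sspan'.
have eB' i x : `|e i x| <= `|B| by rewrite (le_trans (eB i x))// ler_norm.
exists (\sum_i C * (`|E i| + `|B|)) => [|u].
  by apply: sumr_ge0 => i _; apply: mulr_ge0 => //; apply: addr_ge0; exact: normr_ge0.
have [c Su cC] := CP u; split.
  rewrite Su (le_trans (ler_norm_sum _ _ _))// mulr_suml; apply: ler_sum => i _.
  rewrite normrZ (le_trans (ler_wpM2r (normr_ge0 _) (cC i)))//.
  by rewrite mulrAC ler_wpM2r// ler_wpM2l// lerDl.
rewrite Su; apply: filterS (EE c) => x ->; rewrite /lin.
rewrite (le_trans (ler_norm_sum _ _ _))// mulr_suml; apply: ler_sum => i _.
rewrite normrM (le_trans (ler_wpM2r (normr_ge0 _) (cC i)))//.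
by rewrite mulrAC ler_wpM2r// ler_wpM2l// (le_trans (eB' i x))// lerDr.
Qed.

Let q (v : L2) x := - (alpha^-1 * p_h S z (y_h S v) x).

Lemma q_lin v : exists c, \forall x \ae mu, q v x = lin c x.
Proof.
have [c cP] := Sspan (S v - z); exists (fun i => - alpha^-1 * c i).
apply: filterS cP => x; rewrite /q /p_h /y_h => ->.
by rewrite -mulNr /lin mulr_sumr; apply: eq_bigr => i _; rewrite mulrA.
Qed.

(** The datum [z] cancels, so the increment of [q] depends on [s] alone. *)
Lemma q_shift v s : \forall x \ae mu, q (v + s) x = q v x - alpha^-1 * S (S s) x.
Proof.
apply: filterS (Lspace_aeD (S (S v - z)) (S (S s))) => x.
rewrite -S_D addrAC -S_D /q /p_h /y_h => ->.
by rewrite mulrDr opprD.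
Qed.

Lemma SS_bound : exists2 C : R, 0 <= C & forall s : L2,
  `|S (S s)| <= C * `|s| /\ \forall x \ae mu, `|S (S s) x| <= C * `|s|.
Proof.
have [C C0 CP] := S_bound; exists (C * C) => [|s]; first exact: mulr_ge0.
have [[Cs _] [CSs aCSs]] := (CP s, CP (S s)).
have h : C * `|S s| <= C * C * `|s| by rewrite -mulrA ler_wpM2l.
split; first exact: le_trans CSs h.
by apply: filterS aCSs => x xs; exact: le_trans xs h.
Qed.

Lemma measurable_proj c c' c'' :
  measurable_fun setT (fun x => proj (lin c x) (lin c' x) (lin c'' x)).
Proof.
apply: measurable_maxr; first exact: measurable_lin.
by apply: measurable_minr; exact: measurable_lin.
Qed.

(** The bounds [a] and [b] are known only almost everywhere, so the projection is first formed from
    the measurable representatives [lin]; it is dominated by the sum of the absolute values of the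
    bounds. *)
Lemma exists_G_h : exists G : L2 -> L2, is_G_h S S z alpha a b G.
Proof.
suff GP (v : L2) : exists u : L2, \forall x \ae mu, u x = v x - proj (a x) (b x) (q v x).
  have [G Gv] := choice GP; exists G => v.
  by apply: filterS (Gv v) => x -> .
have [c cP] := q_lin v.
pose P x := proj (lin ca x) (lin cb x) (lin c x).
have [U UP] : exists U : L2, \forall x \ae mu, U x = P x.
  apply: Lfun_L2; pose f x := `|lin ca x| + `|lin cb x|.
  have := Lfun_addr_closed mu (lee1n 2) => -[_ addL].
  apply: (@le_Lfun2 _ _ _ _ P f (measurable_proj _ _ _)).
    have L c' : (fun x => `|lin c' x|) \in Lfun mu 2%:E.
      apply: (le_Lfun2 _ (lin_Lfun2 c')).
        by apply: measurableT_comp => //; exact: measurable_lin.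
      by apply: filterE => x; rewrite normr_id.
    exact: addL (L ca) (L cb).
  apply: filterS3 aE bE ab => x ax bx abx.
  rewrite [leRHS]ger0_norm ?addr_ge0// /P /f -ax -bx.
  exact/proj_norm_le/ltW.
exists (v - U).
have PE : \forall x \ae mu, P x = proj (a x) (b x) (q v x).
  by apply: filterS3 aE bE cP => x -> -> ->.
by apply: filterS3 (Lspace_aeB v U) UP PE => x -> -> ->.
Qed.

(** Up to the summand [s], the increment of [G] is a difference of projections whose arguments
    differ by [alpha^-1 * S (S s)]. *)
Lemma G_h_lipschitz (G : L2 -> L2) : is_G_h S S z alpha a b G ->
  exists2 C : R, 0 <= C & forall v s, `|G (v + s) - G v| <= C * `|s|.
Proof.
move=> GP; have [C C0 CP] := SS_bound.
exists (1 + alpha^-1 * C) => [|v s].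
  by apply: addr_ge0 => //; apply: mulr_ge0 => //; rewrite invr_ge0 (ltW alpha0).
rewrite -[X in `|X|](subrK s) addrC (le_trans (ler_normD _ _))//.
rewrite mulrDl mul1r lerD2l -mulrA.
apply: le_trans (_ : alpha^-1 * `|S (S s)| <= _); last first.
  by rewrite ler_wpM2l ?invr_ge0 ?(ltW alpha0)//; have [] := CP s.
apply: L2_norm_le; first by rewrite invr_ge0 (ltW alpha0).
have h1 := ae_and (ae_and (Lspace_aeB (G (v + s) - G v) s)
  (Lspace_aeB (G (v + s)) (G v))) (ae_and (GP (v + s)) (GP v)).
have h2 := ae_and (ae_and (Lspace_aeD v s) (q_shift v s)) ab.
apply: ae_imply (ae_and h1 h2) _.
move=> x [[[-> ->] [/(_ I) -> /(_ I) ->]] [[-> qE] /ltW abx]].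
rewrite -/(q v x) -/(q (v + s) x) qE.
rewrite (_ : _ - _ = proj (a x) (b x) (q v x) -
  proj (a x) (b x) (q v x - alpha^-1 * S (S s) x)); last by ring.
apply: le_trans (proj_lipschitz _ _ abx) _.
by rewrite opprB addrCA subrr addr0 normrM ger0_norm// invr_ge0 (ltW alpha0).
Qed.

Lemma G_h_remainder (G : L2 -> L2) v : is_G_h S S z alpha a b G ->
  exists2 K : R, 0 <= K & forall s (M : {linear L2 -> L2}),
    dG_h S S z alpha a b (v + s) M ->
    `|G (v + s) - G v - M s| ^+ 2 <= K * `|s| ^+ 3.
Proof.
move=> GP; have [C C0 CP] := SS_bound; have [c cP] := q_lin v.
(* Coefficients of [q v - a] and [q v - b]. They depend on [v] only, so the strip constants are
   fixed before [s] and [M]. *)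
pose ka i := c i - ca i; pose kb i := c i - cb i.
have [Ka Ka0 KaP] := sublevel_lin ka; have [Kb Kb0 KbP] := sublevel_lin kb.
have al0 : 0 <= alpha^-1 by rewrite invr_ge0 (ltW alpha0).
exists ((alpha^-1 * C) ^+ 3 * (Ka + Kb)) => [|s M [_ [g [_ gd gM]]]].
  by rewrite mulr_ge0 ?exprn_ge0 ?mulr_ge0 ?addr_ge0.
pose D := alpha^-1 * (C * `|s|).
have D0 : 0 <= D by rewrite !mulr_ge0.
pose lev k := [set x | 0 < `|lin k x| <= D].
have mlev k : measurable (lev k).
  rewrite (_ : lev k = setT `&` (fun x => `|lin k x|) @^-1` `]0, D]).
    by apply: measurableT_comp => //; exact: measurable_lin.
  by apply/seteqP; split=> x /=; rewrite /lev/= in_itv/= => -[].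
(* Two powers of [D] come from the height of the remainder, the third from the measure of the
   strips. *)
rewrite (_ : _ * _ ^+ 3 = D ^+ 2 * ((Ka + Kb) * D)); last by rewrite /D; ring.
apply: (@L2_norm_le_indic _ _ _ _ _ (lev ka `|` lev kb)).
- exact: measurableU.
- rewrite mulrDl EFinD; apply: le_trans (measureU2 _ _ _) _ => //.
  by apply: leeD; [exact: KaP|exact: KbP].
have h1 := ae_and (ae_and (Lspace_aeB (G (v + s) - G v) (M s))
  (Lspace_aeB (G (v + s)) (G v))) (ae_and (GP (v + s)) (GP v)).
have h2 := ae_and (ae_and (Lspace_aeD v s) (q_shift v s)) (ae_and ab gd).
have h3 := ae_and (ae_and aE bE) (ae_and cP (gM s)).
have h4 : \forall x \ae mu, `|alpha^-1 * S (S s) x| <= D.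
  have [_ h] := CP s; apply: filterS h => x xs.
  by rewrite normrM ger0_norm// ler_wpM2l.
apply: ae_imply (ae_and (ae_and h1 h2) (ae_and h3 h4)) _.
move=> x [[[[-> ->] [/(_ I) -> /(_ I) ->]] [[-> qE] [abx dg]]]
  [[[ax bx] [qx /(_ I) ->]] tD]].
move: dg; rewrite -/(q v x) -/(q (v + s) x) qE.
set t := - (alpha^-1 * S (S s) x) => dg.
rewrite (_ : _ - _ = - (proj (a x) (b x) (q v x + t) - proj (a x) (b x) (q v x)
  - g x * t)); last by rewrite /t; ring.
rewrite normrN indicE; case: (boolP (x \in _)) => [_|].
  by rewrite mulr1 (le_trans (dproj_remainder_le abx dg))// /t normrN.
move=> /negP xlev; rewrite mulr0 dproj_remainder0 ?normr0//.
(* Since [|t| <= D], a point that is exceptional for [t] lies in one of the strips of width [D]. *)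
move=> h; apply: xlev; rewrite inE; move: h.
rewrite /t normrN /lev /= -!lin_sub -qx -ax -bx.
by move=> [] /andP[h1' h2']; [left|right]; rewrite h1' (le_trans h2').
Qed.

(** The witness [g] is the indicator of the set where neither bound is active, written with the
    representatives [lin] so as to be measurable. At a bound it takes the value [0], which [[0, 1]]
    admits. *)
Lemma dG_h_nonempty v : dG_h S S z alpha a b v !=set0.
Proof.
have [C C0 CP] := SS_bound; have [c cP] := q_lin v.
pose A := [set x | lin ca x < lin c x] `&` [set x | lin c x < lin cb x].
have mA : measurable A.
  have mlt c1 c2 : measurable [set x | lin c1 x < lin c2 x].
    rewrite (_ : [set x | _] = setT `&` (lin c2 \- lin c1) @^-1` `]0, +oo[).
      by apply: measurable_funB => //; exact: measurable_lin.
    by apply/seteqP; split=> x /=; rewrite in_itv/= andbT subr_gt0// => -[].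
  by apply: measurableI; exact: mlt.
pose g : 'rV[R]_d -> R := \1_A.
have mg : measurable_fun setT g by exact: measurable_indic.
have g01 x : 0 <= g x <= 1.
  by rewrite /g indicE; case: (_ \in _) => /=; rewrite lexx ?ler01.
have SSl k (u w : L2) : S (S (k *: u + w)) = k *: S (S u) + S (S w).
  by rewrite !S_linear.
have MP (w : L2) : exists u : L2,
    \forall x \ae mu, u x = w x + alpha^-1 * (g x * S (S w) x).
  have [U UP] : exists U : L2, \forall x \ae mu, U x = g x * S (S w) x.
    apply: Lfun_L2; apply: (le_Lfun2 _ (L2_Lfun (S (S w)))).
      by apply: measurable_funM => //; exact: measurable_L2.
    apply: filterE => x; have /andP[g0 g1] := g01 x.
    by rewrite normrM (ger0_norm g0) ler_piMl.
  exists (w + alpha^-1 *: U).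
  by apply: filterS3 (Lspace_aeD w (alpha^-1 *: U)) (Lspace_aeZ alpha^-1 U) UP
    => x -> -> ->.
have [M0 M0P] := choice MP.
have M0l : linear M0.
  move=> k u w; apply: Lspace_ae_eq.
  have h1 := ae_and (ae_and (M0P (k *: u + w)) (M0P u)) (M0P w).
  have h2 := ae_and (ae_and (Lspace_aeD (k *: u) w) (Lspace_aeZ k u))
    (ae_and (Lspace_aeD (k *: M0 u) (M0 w)) (Lspace_aeZ k (M0 u))).
  have h3 := ae_and (Lspace_aeD (k *: S (S u)) (S (S w))) (Lspace_aeZ k (S (S u))).
  apply: ae_imply (ae_and (ae_and h1 h2) h3) _.
  move=> x [[[[-> Mu] Mw] [[-> ->] [-> ->]]]].
  by rewrite Mu Mw SSl => -[-> ->]; ring.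
pose M : {linear L2 -> L2} := HB.pack M0 (GRing.isLinear.Build R L2 L2 *:%R M0 M0l).
exists M; split.
  exists (1 + alpha^-1 * C) => w.
  rewrite -[X in `|X|](subrK w) addrC (le_trans (ler_normD _ _))//.
  rewrite mulrDl mul1r lerD2l -mulrA.
  apply: le_trans (_ : alpha^-1 * `|S (S w)| <= _); last first.
    by rewrite ler_wpM2l ?invr_ge0 ?(ltW alpha0)//; have [] := CP w.
  apply: L2_norm_le; first by rewrite invr_ge0 (ltW alpha0).
  apply: ae_imply (ae_and (Lspace_aeB (M0 w) w) (M0P w)) _ => x [-> ->].
  rewrite addrC addrA addNr add0r normrM ger0_norm ?invr_ge0 ?(ltW alpha0)//.
  rewrite ler_wpM2l ?invr_ge0 ?(ltW alpha0)//; have /andP[g0 g1] := g01 x.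
  by rewrite normrM (ger0_norm g0) ler_piMl.
exists g; split.
- rewrite inE; apply/andP; split; rewrite inE//= /finite_norm unlock.
  case: ifPn => // _; apply: le_lt_trans (ltry 1).
  apply: ess_sup_ler => x; rewrite lee_fin; have /andP[g0 g1] := g01 x.
  by rewrite ger0_norm.
- apply: ae_imply (ae_and (ae_and aE bE) cP) _ => x [[ax bx]].
  rewrite /q => ->; rewrite /dproj /g indicE ax bx.
  have -> : (x \in A) = (lin ca x < lin c x < lin cb x).
    by apply/idP/andP => [|[h1 h2]]; rewrite inE// => -[].
  case: ifPn => //= _; case: ifPn => //= _.
  by rewrite in_itv/= lexx ler01.
- by move=> w; apply: ae_imply (M0P w) _ => x ->.
Qed.

Lemma G_h_semismooth (G : L2 -> L2) (mu' : R) : is_G_h S S z alpha a b G ->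
  0 < mu' -> mu' < 3^-1 -> semismooth G (dG_h S S z alpha a b) mu'.
Proof.
move=> GP m0 m3; apply: lipschitz_semismooth => //.
- by have [C _ CP] := G_h_lipschitz GP; exists C.
- exact: dG_h_nonempty.
- by move=> v M [].
- move=> v; have [K _ KP] := G_h_remainder v GP.
  by exists K => s M; exact: KP.
Qed.

End abstract_semismoothness.

(** * Measure of the strips around the zero set of an affine function *)

Section sublevel.
Context {R : realType}.
Local Notation TR := (measurableTypeR R).

(** Tonelli in the head coordinate: sections over [B] have length at most [L], at a position [u]
    that may vary with [t], and the other sections are empty. *)
Lemma lebesgue_tupleS_le n (A : set (n.+1.-tuple TR)) (B : set (n.-tuple TR))
    (L : R) : measurable A -> measurable B -> 0 <= L ->
  (forall t : n.-tuple TR, exists u : R, forall x : R, A (tuple_of_pair (t, x)) ->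
     B t /\ u <= x <= u + L) ->
  (lebesgue_tuple n.+1 A <= L%:E * lebesgue_tuple n B)%E.
Proof.
move=> mA mB L0 AB; pose A' := @tuple_of_pair R n @^-1` A.
have mA' : measurable A'.
  by rewrite -[X in measurable X]setTI; exact: measurable_tuple_of_pair.
have mx t : measurable (xsection A' t) by exact: measurable_xsection.
change (\int[lebesgue_tuple n]_t lebesgue_measure (xsection A' t) <=
  L%:E * lebesgue_tuple n B)%E.
apply: (@le_trans _ _ (\int[lebesgue_tuple n]_t (L%:E * (\1_B t)%:E))%E); last first.
  rewrite ge0_integralZl//.
  - by rewrite integral_indic// setIT.
  - exact: measurableT_comp.
apply: ge0_le_integral => //.
- exact: (measurable_fun_xsection _ mA').
- by apply: emeasurable_funM => //; exact: measurableT_comp.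
- move=> t _; have [Bt|Bt] := pselect (B t); last first.
    rewrite (_ : xsection A' t = set0) ?measure0//; last first.
      rewrite -subset0 => x; rewrite /xsection/= inE => Ax.
      by have [u /(_ x Ax)[]] := AB t.
    by rewrite mule_ge0// lee_fin.
  have [u uP] := AB t; rewrite indicE mem_set//= mule1.
  apply: (@le_trans _ _ (lebesgue_measure (`[u, (u + L)%R]%classic : set R))).
    apply: le_measure; rewrite ?inE//.
    by move=> x; rewrite /xsection/= inE => /uP[_]; rewrite in_itv.
  rewrite lebesgue_measure_itv/= lte_fin ltrDl; case: ifPn => // _.
  by rewrite -EFinD (addrC u) addrK.
Qed.

Definition box (r : R) n : set (n.-tuple TR) :=
  [set t | forall i, `|tnth t i| <= r].

(** The strict lower bound keeps an estimate linear in [e] true for the zero function, whose zero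
    set is the whole box. *)
Definition sublevel (r : R) n (c : 'I_n -> R) (c0 e : R) : set (n.-tuple TR) :=
  [set t | box r t /\ 0 < `|\sum_i c i * tnth t i + c0| <= e].

Lemma measurable_box r n : measurable (@box r n).
Proof.
rewrite (_ : @box r n = \big[setI/setT]_(i <- enum 'I_n)
    ((fun t : n.-tuple TR => tnth t i : R) @^-1` `[- r, r])).
  apply: bigsetI_measurable => i _; rewrite -[X in measurable X]setTI.
  by apply: (@measurable_tnth _ TR n i) => //.
rewrite -bigcap_seq; apply/seteqP; split=> t /= tz i.
  by move=> _ /=; rewrite in_itv/= -ler_norml.
by have := tz i; rewrite /= mem_enum inE in_itv/= -ler_norml; exact.
Qed.

Lemma measurable_sublevel r n c c0 e : measurable (@sublevel r n c c0 e).
Proof.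
pose f (t : n.-tuple TR) : R := `|\sum_i c i * tnth t i + c0|.
have mf : measurable_fun setT f.
  apply: measurableT_comp => //; apply: measurable_funD => //.
  apply: measurable_sum => i; apply: measurable_funM => //.
  exact: (@measurable_tnth _ TR n i).
rewrite (_ : sublevel _ _ _ _ = @box r n `&` (setT `&` f @^-1` `]0, e])).
  by apply: measurableI; [exact: measurable_box|exact: mf].
by apply/seteqP; split=> t /=; rewrite /sublevel /f/= in_itv/= => -[? []].
Qed.

Lemma box_fin r n : exists K : R, (lebesgue_tuple n (@box r n) <= K%:E)%E.
Proof.
elim: n => [|n [K IH]].
  by exists 1; rewrite /= diracE lee_fin; case: (_ \in _).
have [r0|r0] := ltP r 0.
  exists 0; rewrite (_ : @box r n.+1 = set0) ?measure0//.
  by rewrite -subset0 => t /(_ ord0); rewrite leNgt (lt_le_trans r0)//.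
exists (2 * r * K); rewrite EFinM.
apply: le_trans (@lebesgue_tupleS_le n _ (@box r n) (2 * r) _ _ _ _) _.
- exact: measurable_box.
- exact: measurable_box.
- by rewrite mulr_ge0.
- move=> t; exists (- r) => x tx; split=> [i|].
    by have := tx (lift ord0 i); rewrite tnthS.
  have := tx ord0; rewrite tnth0 ler_norml => /andP[-> /=] xr; lra.
- by rewrite lee_wpmul2l// lee_fin mulr_ge0.
Qed.

(** Induction on the dimension. If the leading coefficient vanishes, the head coordinate only
    contributes a factor [2 * r]; otherwise each slice along it lies in an interval of length
    [2 * (e / |c ord0|)], and the box bounds the other coordinates. *)
Lemma sublevel_le r n (c : 'I_n -> R) c0 : exists2 K : R, 0 <= K &
  forall e, 0 <= e -> (lebesgue_tuple n (sublevel r c c0 e) <= (K * e)%:E)%E.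
Proof.
have empty m (c' : 'I_m -> R) c0' e : r < 0 -> (0 < m)%N ->
    sublevel r c' c0' e = set0.
  case: m c' => // m c' r0 _; rewrite -subset0 => t [/(_ ord0)].
  by rewrite leNgt (lt_le_trans r0).
elim: n c => [|n IH] c.
  (* In dimension zero the function is the constant [c0]: the set is empty unless [0 < |c0| <= e],
     and then [1 <= |c0|^-1 * e]. For [c0 = 0] the inverse is [0] by convention. *)
  exists `|c0|^-1 => [|e e0]; first by rewrite invr_ge0.
  have [ce|ce] := boolP (0 < `|c0| <= e); last first.
    rewrite (_ : sublevel _ _ _ _ = set0) ?measure0 ?lee_fin ?mulr_ge0 ?invr_ge0//.
    by rewrite -subset0 => t []; rewrite big_ord0 add0r (negbTE ce).
  move: ce => /andP[c0gt ce]; apply: (@le_trans _ _ 1%E).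
    by rewrite /= diracE lee_fin; case: (_ \in _).
  by rewrite lee_fin mulrC ler_pdivlMr// mul1r.
have [r0|r0] := ltP r 0.
  by exists 0 => // e e0; rewrite empty// measure0 mul0r.
pose c' i := c (lift ord0 i).
have sumE t x : \sum_i c i * tnth (@tuple_of_pair R n (t, x)) i + c0 =
    c ord0 * x + (\sum_i c' i * tnth t i + c0).
  by rewrite big_ord_recl tnth0 -addrA; congr (_ + (_ + _));
     apply: eq_bigr => i _; rewrite tnthS.
have boxE t x : box r (@tuple_of_pair R n (t, x)) -> box r t /\ `|x| <= r.
  move=> tx; split=> [i|]; first by have := tx (lift ord0 i); rewrite tnthS.
  by have := tx ord0; rewrite tnth0.
have [c00|c00] := eqVneq (c ord0) 0.
  have [K K0 KP] := IH c'; exists (2 * r * K) => [|e e0]; first by rewrite !mulr_ge0.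
  apply: le_trans (@lebesgue_tupleS_le n _ (sublevel r c' c0 e) (2 * r) _ _ _ _) _.
  - exact: measurable_sublevel.
  - exact: measurable_sublevel.
  - by rewrite mulr_ge0.
  - move=> t; exists (- r) => x [/boxE[bt xr]]; rewrite sumE c00 mul0r add0r.
    by split=> //; move: xr; rewrite ler_norml => /andP[-> /=] xr; lra.
  - by rewrite -mulrA (EFinM (2 * r)) lee_wpmul2l ?KP// lee_fin mulr_ge0.
have [K KP] := box_fin r n.
have c0gt : 0 < `|c ord0| by rewrite normr_gt0.
exists (2 / `|c ord0| * `|K|) => [|e e0].
  by rewrite mulr_ge0// divr_ge0.
apply: le_trans (@lebesgue_tupleS_le n _ (@box r n) (2 * (e / `|c ord0|)) _ _ _ _) _.
- exact: measurable_sublevel.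
- exact: measurable_box.
- by rewrite mulr_ge0// divr_ge0.
(* The interval is centred at the zero of the function of [x] alone, with half-width
   [e / |c ord0|]. *)
- move=> t; exists (- ((\sum_i c' i * tnth t i + c0) / c ord0) - e / `|c ord0|).
  move=> x [/boxE[bt _]]; rewrite sumE => /andP[_]; set y := _ + c0 => yx.
  split=> //; have : `|x + y / c ord0| <= e / `|c ord0|.
    rewrite ler_pdivlMr// -normrM mulrDl mulrC divfK//.
  by rewrite ler_norml => /andP[h1 h2]; apply/andP; split; lra.
- rewrite (_ : 2 / _ * _ * e = 2 * (e / `|c ord0|) * `|K|); last by ring.
  rewrite (EFinM (2 * _)) lee_wpmul2l// ?lee_fin ?mulr_ge0 ?divr_ge0//.
  by apply: le_trans KP _; rewrite lee_fin ler_norm.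
Qed.

End sublevel.

(** * Integrals up to null sets, and finite measures *)

Section ae_integral.
Context d (T : measurableType d) (R : realType).
Variable mu : {measure set T -> \bar R}.
Import HBNNSimple.
Local Open Scope ereal_scope.

(* [f] and [g] may fail to be measurable on the exceptional null set, in which
   case [ae_eq_integral] does not apply. *)
Lemma ae_eq_integral_nonmeasurable (f g : T -> \bar R) :
  (\forall x \ae mu, f x = g x) -> \int[mu]_x f x = \int[mu]_x g x.
Proof.
suff le_ge0 (u v : T -> \bar R) : (forall x, 0 <= u x) -> (forall x, 0 <= v x) ->
    (\forall x \ae mu, u x = v x) -> \int[mu]_x u x <= \int[mu]_x v x.
  have eq_ge0 (u v : T -> \bar R) : (forall x, 0 <= u x) -> (forall x, 0 <= v x) ->
      (\forall x \ae mu, u x = v x) -> \int[mu]_x u x = \int[mu]_x v x.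
    move=> u0 v0 uv; apply/eqP; rewrite eq_le !le_ge0//.
    by apply: filterS uv => x ->.
  move=> fg; rewrite integralE [RHS]integralE; congr (_ - _); apply: eq_ge0 => //.
    by apply: filterS fg => x; rewrite !funeposE => ->.
  by apply: filterS fg => x; rewrite !funenegE => ->.
move=> u0 v0 [N [mN N0 uvN]].
rewrite ge0_integralTE// ge0_integralTE//.
apply: ge_ereal_sup => _ [h /= hu <-].
have mNC := measurableC mN.
(* A simple function below [u], set to zero on the null set [N], lies below [v] everywhere and keeps
   its integral. *)
apply: ereal_sup_ge; exists (sintegral mu (proj_nnsfun h mNC)).
  exists (proj_nnsfun h mNC) => //= x; rewrite mindicE.
  have [xN|xN] := boolP (x \in ~` N); last by rewrite mulr0.
  rewrite mulr1; have <- : u x = v x.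
    have [//|/uvN xN'] := pselect (u x = v x).
    by move: xN; rewrite inE => /(_ xN').
  exact: hu.
rewrite -mrestrict -integral_nnsfun// -[leLHS](_ : \int[mu]_x (h x)%:E = _).
  rewrite (ge0_negligible_integral mN)//= ?setTD//.
    by apply/measurable_EFinP; exact: measurable_funPT.
  by move=> x _; rewrite lee_fin.
by rewrite integral_nnsfun// patch_setT.
Qed.

Lemma bounded_Lfun2 (f : T -> R) (B : R) : mu setT < +oo ->
  measurable_fun setT f -> (forall x, `|f x| <= B)%R -> f \in Lfun mu 2%:E.
Proof.
move=> muT mf fB; rewrite inE; apply/andP; split; rewrite inE//=.
rewrite /finite_norm unlock poweR_lty//.
apply: (@le_lt_trans _ _ (\int[mu]_x (cst (B ^+ 2)%:E) x)).
  apply: ge0_le_integral => //.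
  - by move=> x _; exact: poweR_ge0.
  - apply: (@measurableT_comp _ _ _ _ _ _ (fun x : \bar R => x `^ 2)).
      exact: measurable_poweR.
    by apply: measurableT_comp => //; exact/measurable_EFinP.
  - move=> x _; rewrite /= lee_fin powR_mulrn// ler_sqr ?nnegrE//.
    exact: (le_trans _ (fB x)).
by rewrite integral_cst// lte_mul_pinfty// lee_fin sqr_ge0.
Qed.

Lemma measure_bigsetU_le n (F : 'I_n -> set T) :
  (forall i, measurable (F i)) ->
  mu (\big[setU/set0]_i F i) <= \sum_i mu (F i).
Proof.
move=> mF; suff [] : measurable (\big[setU/set0]_i F i) /\
  mu (\big[setU/set0]_i F i) <= \sum_i mu (F i) by [].
elim/big_ind2 : _ => [|a A b B [mA Aa] [mB Bb]|i _]; first by rewrite measure0.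
  split; first exact: measurableU.
  by apply: (le_trans (measureU2 mu mA mB)); exact: leeD.
by split.
Qed.

End ae_integral.

(** * Piecewise affine functions on a simplicial partition *)

Section simplices.
Context {R : realType} {d : nat}.
Implicit Types (x : 'rV[R]_d) (p : 'I_d.+1 -> 'rV[R]_d).

Lemma measurable_coord (i : 'I_d) : measurable_fun setT (fun x : 'rV[R]_d => x 0 i).
Proof.
apply: (measurability _ (RGenOpens.measurableE R)).
move=> _ [_ [a [b ->] <-]]; rewrite setTI; apply: open_measurable_rV.
by have /continuousP := @coord_continuous R 1 d 0 i; apply; exact: interval_open.
Qed.

(* Homogeneous coordinates: affine functions of [x] are linear in [homog x]. *)
Definition homog x : 'rV[R]_(1 + d) := row_mx 1%:M x.

Lemma measurable_homog i : measurable_fun setT (fun x : 'rV[R]_d => homog x 0 i).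
Proof.
case: (split_ordP i) => k ->.
  by rewrite (_ : (fun _ => _) = cst (1%:M 0 k))//; apply/funext => x; rewrite row_mxEl.
rewrite (_ : (fun _ => _) = fun x : 'rV[R]_d => x 0 k); first exact: measurable_coord.
by apply/funext => x; rewrite row_mxEr.
Qed.

Lemma homog0 x : homog x 0 (lshift d 0) = 1.
Proof. by rewrite row_mxEl mxE eqxx. Qed.

Definition vertex_mx p : 'M[R]_(1 + d) := \matrix_(k < 1 + d) homog (p k).

(** The leading ones of the homogeneous coordinates turn a vanishing combination of rows into the
    two equations of an affine dependence. *)
Lemma affinely_independent_unitmx p : affinely_independent p ->
  vertex_mx p \in unitmx.
Proof.
move=> pind; rewrite -row_free_unit; apply: inj_row_free => v vp0.
have vE i : \sum_(k < d.+1) v 0 k * homog (p k) 0 i = 0.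
  suff -> : \sum_(k < d.+1) v 0 k * homog (p k) 0 i = (v *m vertex_mx p) 0 i.
    by rewrite vp0 mxE.
  rewrite [RHS]mxE.
  by apply: eq_bigr => k _; rewrite [X in _ = _ * X]mxE.
apply/rowP => k; rewrite mxE; apply: (pind (fun k => v 0 k)).
  have := vE (lshift d 0); under eq_bigr do rewrite row_mxEl mxE mulr1.
  by [].
apply/rowP => i; have := vE (rshift 1 i); rewrite summxE mxE => vi.
by rewrite -[RHS]vi; apply: eq_bigr => j _; rewrite row_mxEr mxE.
Qed.

Lemma homog_comb n (t : 'I_n -> R) (q : 'I_n -> 'rV[R]_d) : \sum_i t i = 1 ->
  homog (\sum_i t i *: q i) = \sum_i t i *: homog (q i).
Proof.
move=> t1; apply/rowP => k; rewrite [RHS]summxE.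
under [RHS]eq_bigr do rewrite mxE.
case: (split_ordP k) => i ->.
  rewrite row_mxEl mxE ord1 eqxx -t1; apply: eq_bigr => j _.
  by rewrite row_mxEl mxE eqxx mulr1.
rewrite row_mxEr summxE; apply: eq_bigr => j _.
by rewrite row_mxEr mxE.
Qed.

Lemma homog_inj x y : homog x = homog y -> x = y.
Proof. by move/eq_row_mx => []. Qed.

Definition barycentric p x : 'rV[R]_(1 + d) := homog x *m invmx (vertex_mx p).

Lemma barycentricK p x : vertex_mx p \in unitmx ->
  homog x = \sum_(k < d.+1) barycentric p x 0 k *: homog (p k).
Proof.
move=> pU; rewrite -[LHS](mulmxKV pU) mulmx_sum_row.
by apply: eq_bigr => k _; rewrite rowK.
Qed.

(** Barycentric coordinates respect convex combinations and are unit vectors at the vertices;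
    conversely they sum to one, by the leading coordinate. The hull becomes finitely many linear
    inequalities, whence its measurability. *)
Lemma simplexP p x : affinely_independent p ->
  simplex p x <-> forall k, 0 <= barycentric p x 0 k.
Proof.
move=> /affinely_independent_unitmx pU; split=> [[n [q [t [qp t0 t1 ->]]]] k|x0].
  have /choice[s sP] : forall i, exists k', q i = p k'.
    by move=> i; have [k' _ <-] := qp i; exists k'.
  rewrite /barycentric homog_comb// mulmx_suml summxE sumr_ge0// => i _.
  rewrite -scalemxAl mxE mulr_ge0// sP.
  have -> : homog (p (s i)) = row (s i) (vertex_mx p) by rewrite rowK.
  by rewrite -row_mul mulmxV// !mxE ler0n.
have hx := barycentricK x pU.
have t1 : \sum_(k < d.+1) barycentric p x 0 k = 1.
  rewrite -[RHS](homog0 x) [in RHS]hx summxE; apply: eq_bigr => k _.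
  by rewrite [RHS]mxE homog0 mulr1.
exists d.+1, p, (fun k => barycentric p x 0 k); split => //.
by apply: homog_inj; rewrite homog_comb.
Qed.

Lemma measurable_simplex p : affinely_independent p -> measurable (simplex p).
Proof.
move=> pind; rewrite (_ : simplex p = \bigcap_(k in [set: 'I_d.+1])
    (setT `&` (fun x => barycentric p x 0 k) @^-1` `[0, +oo[)).
  apply: fin_bigcap_measurable; first exact: finite_finset.
  move=> k _; suff mk : measurable_fun setT (fun x => barycentric p x 0 k).
    exact: mk.
  rewrite /barycentric; under eq_fun do rewrite mxE.
  by apply: measurable_sum => i; apply: measurable_funM => //; exact: measurable_homog.
apply/seteqP; split=> x /=.
  by move=> /(simplexP _ pind) xk k _ /=; rewrite in_itv/= andbT.
by move=> xk; apply/(simplexP _ pind) => k; have [_] := xk k I; rewrite /= in_itv/= andbT.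
Qed.

End simplices.

(** * A bounded spanning family for the piecewise affine functions *)

Section cells.
Context {R : realType} {d : nat} {Omega : set 'rV[R]_d} (oOmega : open Omega).
Context {nt : nat} (T : 'I_nt -> 'I_d.+1 -> 'rV[R]_d).
Context (Tind : forall j, affinely_independent (T j)).
Context (OmegaT : Omega `<=` \bigcup_j simplex (T j)).
Context (r : R) (Omegar : forall x i, Omega x -> `|x 0 i| <= r).
Local Notation mu := (lebesgue_on oOmega).

(* Each point of [Omega] is assigned to the first simplex that contains it. *)
Definition cell (j : 'I_nt) : set 'rV[R]_d :=
  Omega `&` simplex (T j) `\` \bigcup_(k in [set k : 'I_nt | (k < j)%N]) simplex (T k).

Lemma measurable_cell j : measurable (cell j).
Proof.
apply: measurableD; first apply: measurableI.
- exact: open_measurable_rV.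
- exact: measurable_simplex.
- apply: fin_bigcup_measurable; first exact: finite_finset.
  by move=> k _; exact: measurable_simplex.
Qed.

Lemma cell_uniq i j x : cell i x -> cell j x -> i = j.
Proof.
move=> [[_ xi] ni] [[_ xj] nj]; apply/val_inj => /=.
by have [ij|ij|//] := ltngtP i j; [case: nj|case: ni]; [exists i|exists j].
Qed.

Lemma cell_cover x : Omega x -> exists j, cell j x.
Proof.
move=> Ox; have [j0 _ xj0] := OmegaT Ox.
pose P (j : 'I_nt) := `[< simplex (T j) x >].
have xP : P j0 by exact/asboolP.
case: (arg_minnP (@nat_of_ord nt) xP) => j /asboolP xj jmin.
exists j; split => // -[k /= kj xk].
by have := jmin k (asboolT xk); rewrite leqNgt kj.
Qed.

(** The constant and the coordinates, cut off to each cell. Their span contains discontinuous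
    functions; all that matters is that it is finite-dimensional and contains [W_h] on [Omega]. *)
Definition cell_fun (k : 'I_#|{: 'I_nt * 'I_(1 + d)}|) (x : 'rV[R]_d) : R :=
  \1_(cell (enum_val k).1) x * homog x 0 (enum_val k).2.

Lemma measurable_cell_fun k : measurable_fun setT (cell_fun k).
Proof.
apply: measurable_funM; last exact: measurable_homog.
by apply: measurable_indic; exact: measurable_cell.
Qed.

Lemma cell_fun_le k x : `|cell_fun k x| <= 1 + `|r|.
Proof.
rewrite /cell_fun indicE; case: (boolP (x \in _)) => [|_]; last first.
  by rewrite mul0r normr0 addr_ge0.
rewrite inE => -[[Ox _] _]; rewrite mul1r.
case: (split_ordP (enum_val k).2) => i ->.
  by rewrite row_mxEl mxE ord1 eqxx normr1 lerDl.
rewrite row_mxEr (le_trans (Omegar i Ox))// (le_trans (ler_norm r))//.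
by rewrite lerDr.
Qed.

Lemma cell_fun_sum c j x : cell j x ->
  \sum_k c k * cell_fun k x = \sum_(i < 1 + d) c (enum_rank (j, i)) * homog x 0 i.
Proof.
move=> xj; rewrite (reindex (@enum_rank {: 'I_nt * 'I_(1 + d)}))/=; last first.
  exact/onW_bij/enum_rank_bij.
transitivity (\sum_j' \sum_(i < 1 + d)
    c (enum_rank (j', i)) * cell_fun (enum_rank (j', i)) x).
  by rewrite pair_bigA; apply: eq_bigr => -[].
rewrite (bigD1 j)//= [X in _ + X]big1 ?addr0.
  by apply: eq_bigr => i _; rewrite /cell_fun enum_rankK indicE mem_set// mul1r.
move=> k kj; apply: big1 => i _; rewrite /cell_fun enum_rankK indicE memNset.
  by rewrite mul0r mulr0.
by move=> /= xk; move: kj; rewrite (cell_uniq xk xj) eqxx.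
Qed.

Lemma affine_homog (c : 'rV[R]_d) (c0 : R) x :
  dotv c x + c0 = \sum_(i < 1 + d) row_mx c0%:M c 0 i * homog x 0 i.
Proof.
rewrite big_split_ord big_ord1 homog0 row_mxEl mxE eqxx mulr1 addrC; congr (_ + _).
by apply: eq_bigr => i _; rewrite !row_mxEr.
Qed.

Lemma W_h_span v : W_h Omega T v ->
  exists c, forall x, Omega x -> v x = \sum_k c k * cell_fun k x.
Proof.
move=> [_ vT]; have /choice[c cP] : forall j, exists w : 'rV[R]_(1 + d),
    forall x, simplex (T j) x -> v x = \sum_i w 0 i * homog x 0 i.
  move=> j; have [c [c0 vE]] := vT j; exists (row_mx c0%:M c) => x xj.
  by rewrite vE// affine_homog.
exists (fun k => c (enum_val k).1 0 (enum_val k).2) => x /cell_cover[j xj].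
rewrite (cell_fun_sum _ xj) (cP j)//; last by case: xj => -[].
by apply: eq_bigr => i _; rewrite enum_rankK.
Qed.

(** Carries estimates for the iterated product measure on tuples over to [mu], by subadditivity over
    a finite cover. *)
Lemma lebesgue_on_le (A : set 'rV[R]_d) n (F : 'I_n -> set (d.-tuple (measurableTypeR R)))
    (K : 'I_n -> R) : measurable A -> (forall i, measurable (F i)) ->
  (forall i, lebesgue_tuple d (F i) <= (K i)%:E)%E ->
  (forall t, A (row_of_tuple t) -> Omega (row_of_tuple t) -> exists i, F i t) ->
  (mu A <= (\sum_i K i)%:E)%E.
Proof.
move=> mA mF FK AF.
change (lebesgue_tuple d (@row_of_tuple R d @^-1` (A `&` Omega)) <= (\sum_i K i)%:E)%E.
apply: (@le_trans _ _ (lebesgue_tuple d (\big[setU/set0]_i F i))).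
  apply: le_measure; rewrite ?inE.
  - rewrite -[X in measurable X]setTI; apply: measurable_row_of_tuple => //.
    by apply: measurableI => //; exact: open_measurable_rV.
  - by apply: bigsetU_measurable => i _.
  - move=> t [At Ot]; have [i it] := AF t At Ot.
    by rewrite -bigcup_seq; exists i => //=; rewrite mem_index_enum.
apply: le_trans (measure_bigsetU_le _ mF) _; rewrite -sumEFin.
by apply: lee_sum => i _; exact: FK.
Qed.

Lemma lebesgue_on_fin : (mu setT < +oo)%E.
Proof.
have [K KP] := box_fin r d.
apply: (@le_lt_trans _ _ (\sum_(i < 1) K)%:E); last exact: ltry.
apply: (@lebesgue_on_le _ 1 (fun=> @box R r d)) => //.
- by move=> _; exact: measurable_box.
- move=> t _ Ot; exists ord0 => i; have := Omegar i Ot.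
  by rewrite mxE.
Qed.

(** On each cell the combination is a single affine function, so the set is covered by one strip per
    cell and the constants add up. *)
Lemma cell_fun_sublevel c : exists2 K : R, 0 <= K &
  forall e : R, 0 <= e ->
    (mu [set x | (0 < `|\sum_k c k * cell_fun k x| <= e)%R] <= (K * e)%:E)%E.
Proof.
pose w j (i : 'I_d) := c (enum_rank (j, rshift 1 i)).
pose w0 j := c (enum_rank (j, lshift d 0)).
have wE j x : cell j x ->
    \sum_k c k * cell_fun k x = \sum_i w j i * x 0 i + w0 j.
  move=> xj; rewrite (cell_fun_sum _ xj) big_split_ord big_ord1 homog0 mulr1 addrC.
  by congr (_ + _); apply: eq_bigr => i _; rewrite row_mxEr.
have /choice[K KP] : forall j : 'I_nt, exists K, 0 <= K /\ forall e, 0 <= e ->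
    (lebesgue_tuple d (sublevel r (w j) (w0 j) e) <= (K * e)%:E)%E.
  by move=> j; have [K K0 KP] := sublevel_le r (w j) (w0 j); exists K.
exists (\sum_j K j) => [|e e0]; first by apply: sumr_ge0 => j _; case: (KP j).
rewrite mulr_suml.
apply: (@lebesgue_on_le _ _ (fun j => sublevel r (w j) (w0 j) e)).
- suff mf : measurable_fun setT (fun x => `|\sum_k c k * cell_fun k x|).
    rewrite (_ : [set x | _] = setT `&` (fun x => `|\sum_k c k * cell_fun k x|) @^-1` `]0, e]).
      exact: mf.
    by apply/seteqP; split=> x /=; rewrite in_itv/= => -[].
  apply: measurableT_comp => //; apply: measurable_sum => k.
  by apply: measurable_funM => //; exact: measurable_cell_fun.
- by move=> j; exact: measurable_sublevel.
- by move=> j; have [_] := KP j; exact.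
move=> t /= fte Ot; have [j tj] := cell_cover Ot; exists j; split.
  by move=> i; have := Omegar i Ot; rewrite mxE.
move: fte; rewrite (wE j)//.
by under eq_bigr do rewrite mxE.
Qed.

Lemma lebesgue_on_ae : \forall x \ae mu, Omega x.
Proof.
have mO := open_measurable_rV oOmega.
exists (~` Omega); split => //; first exact: measurableC.
by rewrite /lebesgue_on/= /mrestr setICl measure0.
Qed.

End cells.

(** * The finite element problem *)

Lemma le_coord_norm (R : realType) d (x : 'rV[R]_d) i : `|x 0 i| <= `|x|.
Proof.
have -> : `|x| = \big[Order.max/0]_ij `|x ij.1 ij.2| by exact: mx_normrE.
exact: (le_bigmax _ (fun ij : 'I_1 * 'I_d => `|x ij.1 ij.2|) (0, i)).
Qed.

(* Testing the equation for [Sh u] with the finite element function of [Sh v],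
   and conversely, yields the same stiffness integral. *)
Lemma discrete_solution_operator_sym (R : realType) d (Omega : set 'rV[R]_d)
    (oOmega : open Omega) nt (T : 'I_nt -> 'I_d.+1 -> 'rV[R]_d)
    (Sh : L2 oOmega -> L2 oOmega) : discrete_solution_operator T Sh ->
  forall u v, dot (Sh u) v = dot u (Sh v).
Proof.
move=> ShP u v; have [y [Yy uy yE]] := ShP u; have [y' [Yy' vy' y'E]] := ShP v.
(* A member of [Y_h] has arbitrary values off [closure Omega], so the integral identity must not
   rely on the measurability of [h]. *)
have dE (f g : L2 oOmega) h : (g : 'rV[R]_d -> R) = h %[ae lebesgue_on oOmega] ->
    dot f g = \int[lebesgue_on oOmega]_x (f x * h x).
  move=> gh; congr fine; apply: ae_eq_integral_nonmeasurable.
  by apply: ae_imply gh _ => x ->.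
rewrite dotC; apply: etrans (dE v (Sh u) y uy) _.
apply: etrans (esym (y'E y Yy)) _; apply: etrans _ (esym (dE u (Sh v) y' vy')).
apply: etrans _ (yE y' Yy').
apply: eq_Rintegral => x _; apply: eq_bigr => i _; exact: mulrC.
Qed.

Theorem theorem3p3 (R : realType) (d : nat) (Omega : set 'rV[R]_d)
    (oOmega : open Omega) (nt : nat) (T : 'I_nt -> 'I_d.+1 -> 'rV[R]_d)
    (Sh Sh' : L2 oOmega -> L2 oOmega) (z : L2 oOmega) (alpha sigma : R)
    (a b : 'rV[R]_d -> R) :
  (0 < d)%N ->
  polyhedral_domain Omega ->
  admissible_partition Omega T ->
  discrete_solution_operator T Sh ->
  adjoint_operator Sh Sh' ->
  0 < alpha ->
  W_h Omega T a -> W_h Omega T b ->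
  0 < sigma -> (forall x, Omega x -> sigma < b x - a x) ->
  exists2 G : L2 oOmega -> L2 oOmega,
    is_G_h Sh Sh' z alpha a b G &
    forall mu : R, 0 < mu -> mu < 3^-1 ->
      semismooth G (dG_h Sh Sh' z alpha a b) mu.
Proof.
move=> _ [_ /pinfty_ex_gt0[r _ Or] _ _] [Tind Tcov _ _] ShP Sh'P alpha0 aW bW.
move=> sigma0 ab; have Ssym := discrete_solution_operator_sym ShP.
(* The adjoint is unique because the pairing separates points, and [Sh] is its own adjoint. *)
have -> : Sh' = Sh.
  apply/funext => v; apply: dot_inj => w.
  by rewrite dotC -[RHS]dotC -Ssym; exact/esym/Sh'P.
have OT : Omega `<=` \bigcup_j simplex (T j).
  by rewrite -Tcov; exact: subset_closure.
have Oc x i : Omega x -> `|x 0 i| <= r.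
  by move=> /Or; exact: le_trans (le_coord_norm x i).
have [ca aE] := W_h_span OT aW; have [cb bE] := W_h_span OT bW.
have me := measurable_cell_fun oOmega Tind.
have e2 k := bounded_Lfun2 (lebesgue_on_fin oOmega Oc) (me k) (cell_fun_le T Oc k).
have inO := lebesgue_on_ae oOmega.
have Sspan u : exists c, \forall x \ae lebesgue_on oOmega,
    Sh u x = \sum_k c k * cell_fun (Omega := Omega) T k x.
  have [y [[yW _] uy _]] := ShP u; have [c yE] := W_h_span OT yW; exists c.
  by apply: ae_imply (ae_and uy inO) _ => x [-> // /yE].
have aE' := ae_imply inO aE; have bE' := ae_imply inO bE.
have ab' : \forall x \ae lebesgue_on oOmega, a x < b x.
  by apply: ae_imply inO _ => x /ab/(lt_trans sigma0); rewrite subr_gt0.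
have [G GP] := exists_G_h z alpha me e2 Sspan aE' bE' ab'.
exists G => // mu mu0 mu3.
exact: (G_h_semismooth alpha0 Ssym me e2 (cell_fun_le T Oc) Sspan aE' bE' ab'
  (cell_fun_sublevel oOmega Tind OT Oc)).
Qed.
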